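(* Let $k$ be a field and let $A$ be a non-semisimple self-injective finite dimensional $k$-algebra. Then $$\operatorname{ll}(A)\ \ge\ \operatorname{repdim}A\ \ge\ \operatorname{wrepdim}A\ \ge\ 2+\dim(A\text{-stab}).$$
   Context: $A\text{-mod}$ is the category of finitely generated left $A$-modules. $\operatorname{ll}(A)$ is the Loewy length: the smallest integer $i$ with $J(A)^i=0$, $J(A)$ being the Jacobson radical. $A\text{-stab}$ is the stable category, the quotient of the additive category $A\text{-mod}$ by the additive subcategory of finitely generated projective modules, triangulated via the canonical equivalence $A\text{-stab}\simeq D^b(A\text{-mod})/A\text{-perf}$, where $A\text{-perf}$ is the thick subcategory generated by $A$. Dimension of a triangulated category $\mathcal{T}$: for a subcategory (or object) $\mathcal{I}$, $\langle\mathcal{I}\rangle$ is the smallest full subcategory containing $\mathcal{I}$ and closed under finite direct sums, direct summands and shifts; $\mathcal{I}_1*\mathcal{I}_2$ is the full subcategory of objects $M$ for which there is a distinguished triangle $M_1\to M\to M_2\to M_1[1]$ with $M_i\in\mathcal{I}_i$; $\mathcal{I}_1\diamond\mathcal{I}_2=\langle\mathcal{I}_1*\mathcal{I}_2\rangle$; $\langle\mathcal{I}\rangle_0=0$ and $\langle\mathcal{I}\rangle_i=\langle\mathcal{I}\rangle_{i-1}\diamond\langle\mathcal{I}\rangle$ for $i\ge1$. Then $\dim\mathcal{T}$ is the minimal integer $d\ge0$ such that there is $M\in\mathcal{T}$ with $\mathcal{T}=\langle M\rangle_{d+1}$ (and $\infty$ if there is none). For an object $M$ of an abelian category $\mathcal{A}$,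 $\operatorname{add}(M)$ is the full subcategory of direct summands of finite direct sums of copies of $M$. Representation dimension: $\operatorname{repdim}\mathcal{A}$ is the smallest integer $i\ge2$ such that there is an object $M\in\mathcal{A}$ with the property that for every $L\in\mathcal{A}$: (a) there is an exact sequence $0\to M^{-i+2}\to M^{-i+3}\to\cdots\to M^0\to L\to0$ with all $M^j\in\operatorname{add}(M)$ such that $0\to\operatorname{Hom}(M,M^{-i+2})\to\cdots\to\operatorname{Hom}(M,M^0)\to\operatorname{Hom}(M,L)\to0$ is exact; (b) there is an exact sequence $0\to L\to M'^0\to M'^1\to\cdots\to M'^{i-2}\to0$ with all $M'^j\in\operatorname{add}(M)$ such that $0\to\operatorname{Hom}(M'^{i-2},M)\to\cdots\to\operatorname{Hom}(M'^0,M)\to\operatorname{Hom}(L,M)\to0$ is exact. Weak representation dimension: $\operatorname{wrepdim}\mathcal{A}$ is the smallest integer $i\ge2$ such that there is an object $M\in\mathcal{A}$ with the property that for every $L\in\mathcal{A}$ there is a bounded complex $C=0\to C^r\to\cdots\to C^s\to0$ with terms in $\operatorname{add}(M)$ such that $L$ is isomorphic to a direct summand of $H^0(C)$, $H^d(C)=0$ for $d\ne0$, and $s-r\le i-2$. For a finite dimensional algebra $A$, $\operatorname{repdim}A=\operatorname{repdim}(A\text{-mod})$ and $\operatorname{wrepdim}A=\operatorname{wrepdim}(A\text{-mod})$. *)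

(* Defs.v *)
From HB Require Import structures.
From mathcomp Require Import all_boot all_order all_algebra all_field.
From mathcomp Require Import boolp constructive_ereal.

Set Implicit Arguments.
Unset Strict Implicit.
Unset Printing Implicit Defensive.

Import Order.TTheory GRing.Theory Num.Theory.
Local Open Scope ring_scope.

(* The smallest natural number satisfying P, +oo if there is none; the
   invariants below live in {0, 1, 2, ...} + {+oo}, seen inside \bar int. *)
Definition least (P : nat -> Prop) : \bar int :=
  match pselect (exists n, `[< P n >]) with
  | left exP => ((ex_minn exP)%:Z)%:E
  | right _ => +oo%E
  end.

(* R-mod is meant for Noetherian R: below, R is a finite dimensional algebra. *)
Section FinGenModules.
Variable R : nzRingType.

Definition finitely_generated (M : lmodType R) : Prop :=
  exists n (g : 'I_n -> M),
    forall x, exists c : 'I_n -> R, x = \sum_i c i *: g i.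

Record fgmod := FGMod {
  fg_carrier :> lmodType R;
  fg_fin : finitely_generated fg_carrier }.

Lemma fg_zero : finitely_generated 'rV[R]_0.
Proof.
by exists 0%N, (fun=> 0) => x; exists (fun=> 0); rewrite big_ord0 [x]thinmx0.
Qed.

Lemma fg_regular : finitely_generated R^o.
Proof.
by exists 1%N, (fun=> 1) => x; exists (fun=> x); rewrite big_ord1; exact/esym/mulr1.
Qed.

Lemma fg_prod (M N : lmodType R) : finitely_generated M ->
  finitely_generated N -> finitely_generated (M * N)%type.
Proof.
move=> [m [g gP]] [n [h hP]].
exists (m + n)%N, (fun i => match split i with
  | inl j => (g j, 0) | inr j => (0, h j) end) => -[x y].
have [c ->] := gP x; have [d ->] := hP y.
exists (fun i => match split i with inl j => c j | inr j => d j end).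
have splitl i : split (lshift n i) = inl i := unsplitK (inl i).
have splitr i : split (rshift m i) = inr i := unsplitK (inr i).
have sumE (I : finType) (F : I -> (M * N)%type) :
    \sum_i F i = (\sum_i (F i).1, \sum_i (F i).2).
  by elim/big_rec3: _ => // i a b _ _ ->; case: (F i).
rewrite sumE !big_split_ord; congr pair.
  rewrite [X in _ = _ + X]big1 => [|i _]; last by rewrite splitr /= scaler0.
  by rewrite addr0; apply: eq_bigr => i _; rewrite splitl.
rewrite [X in _ = X + _]big1 => [|i _]; last by rewrite splitl /= scaler0.
by rewrite add0r; apply: eq_bigr => i _; rewrite splitr.
Qed.

Definition mod0 : fgmod := FGMod fg_zero.
Definition regmod : fgmod := FGMod fg_regular.
Definition dsum (M N : fgmod) : fgmod := FGMod (fg_prod (fg_fin M) (fg_fin N)).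
Definition mpow (M : fgmod) (n : nat) : fgmod := iter n (dsum M) mod0.

Definition is_zero (M : lmodType R) : Prop := forall x : M, x = 0.

Definition module_iso (M N : lmodType R) : Prop :=
  exists f : {linear M -> N}, bijective f.

Definition direct_summand (X Y : fgmod) : Prop :=
  exists Z : fgmod, module_iso (dsum X Z) Y.

Definition add_of (M X : fgmod) : Prop := exists n, direct_summand X (mpow M n).

Definition projective (P : lmodType R) : Prop :=
  forall (M N : lmodType R) (g : {linear M -> N}) (h : {linear P -> N}),
    (forall y, exists x, g x = y) ->
    exists l : {linear P -> M}, forall p, g (l p) = h p.

Definition injective_module (E : lmodType R) : Prop :=
  forall (M N : lmodType R) (g : {linear M -> N}) (h : {linear M -> E}),
    injective g ->
    exists l : {linear N -> E}, forall m, l (g m) = h m.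

Definition exact (X Y Z : lmodType R) (f : {linear X -> Y})
    (g : {linear Y -> Z}) : Prop :=
  forall y, g y = 0 <-> exists x, f x = y.

Definition exact_Hom_from (M X Y Z : lmodType R) (f : {linear X -> Y})
    (g : {linear Y -> Z}) : Prop :=
  forall h : {linear M -> Y}, (forall m, g (h m) = 0) <->
    exists h' : {linear M -> X}, forall m, f (h' m) = h m.

Definition exact_Hom_to (M X Y Z : lmodType R) (f : {linear X -> Y})
    (g : {linear Y -> Z}) : Prop :=
  forall h : {linear Y -> M}, (forall x, h (f x) = 0) <->
    exists h' : {linear Z -> M}, forall y, h' (g y) = h y.

(* X j stands for M^{-j}, and X j = 0 for j > n: exactness at X n then says
   that the leftmost map (of modules, resp. of Hom spaces) is injective. *)
Definition add_resolution (n : nat) (M L : fgmod) : Prop :=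
  exists (X : nat -> fgmod) (d : forall j, {linear X j.+1 -> X j})
         (e : {linear X 0%N -> L}),
    [/\ (forall j, add_of M (X j)) /\ (forall j, (n < j)%N -> is_zero (X j)),
        (forall y, exists x, e x = y) /\
        (forall h : {linear M -> L},
           exists h' : {linear M -> X 0%N}, forall m, e (h' m) = h m),
        exact (d 0%N) e /\ exact_Hom_from M (d 0%N) e &
        forall j, exact (d j.+1) (d j) /\ exact_Hom_from M (d j.+1) (d j)].

(* X j stands for M'^j, and X j = 0 for j > n. *)
Definition add_coresolution (n : nat) (M L : fgmod) : Prop :=
  exists (X : nat -> fgmod) (d : forall j, {linear X j -> X j.+1})
         (e : {linear L -> X 0%N}),
    [/\ (forall j, add_of M (X j)) /\ (forall j, (n < j)%N -> is_zero (X j)),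
        injective e /\
        (forall h : {linear L -> M},
           exists h' : {linear X 0%N -> M}, forall y, h' (e y) = h y),
        exact e (d 0%N) /\ exact_Hom_to M e (d 0%N) &
        forall j, exact (d j) (d j.+1) /\ exact_Hom_to M (d j) (d j.+1)].

Definition repdim : \bar int := least (fun i => (2 <= i)%N /\
  exists M : fgmod, forall L : fgmod,
    add_resolution (i - 2) M L /\ add_coresolution (i - 2) M L).

Definition linear_of (U V : lmodType R) (f : U -> V) (fL : linear f) :
  {linear U -> V} := HB.pack f (GRing.isLinear.Build R U V *:%R f fL).

Record bcomplex := BComplex {
  cob :> int -> fgmod;
  cdiff : forall i, {linear cob i -> cob (i + 1)};
  cdiffK : forall i x, cdiff (i + 1) (cdiff i x) = 0;
  cbounded : exists n : int, forall i, n < `|i| -> is_zero (cob i) }.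

(* H is isomorphic to H^{i+1}(C): K is the kernel of d^{i+1}, and H is the
   cokernel of the corestriction of d^i to K. Every degree has the form i + 1,
   and indexing cohomology this way avoids casts between C (i - 1 + 1) and C i. *)
Definition is_cohomology (C : bcomplex) (i : int) (H : fgmod) : Prop :=
  exists (K : lmodType R) (inc : {linear K -> C (i + 1)})
         (quo : {linear K -> H}),
    [/\ injective inc,
        (forall y, cdiff C (i + 1) y = 0 <-> exists z, inc z = y),
        (forall h, exists z, quo z = h) &
        (forall z, quo z = 0 <-> exists x, cdiff C i x = inc z)].

(* Cohomology sits in degree 0 = -1 + 1 only. *)
Definition wrepdim : \bar int := least (fun i => (2 <= i)%N /\
  exists M : fgmod, forall L : fgmod, exists C : bcomplex,
    [/\ forall j, add_of M (C j),
        exists2 H, is_cohomology C (-1) H & direct_summand L H,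
        forall j, j != -1 -> exact (cdiff C j) (cdiff C (j + 1)) &
        exists r s : int, [/\ r <= s, s - r <= i%:Z - 2 &
          forall j, (j < r) || (s < j) -> is_zero (C j)]]).

(* D^b(R-mod) and its Verdier quotient D^b(R-mod)/R-perf are handled through
   their objects, the bounded complexes, and through chain maps: each morphism
   is a roof of chain maps. *)

Record cmap (X Y : bcomplex) := CMap {
  cmapf :> forall i, {linear X i -> Y i};
  cmapC : forall i x, cmapf (i + 1) (cdiff X i x) = cdiff Y i (cmapf i x) }.

Definition quasi_iso (X Y : bcomplex) (f : cmap X Y) : Prop := forall i,
  (forall x, cdiff X (i + 1) x = 0 ->
     (exists y, cdiff Y i y = f (i + 1) x) -> exists x', cdiff X i x' = x) /\
  (forall y, cdiff Y (i + 1) y = 0 ->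
     exists2 x, cdiff X (i + 1) x = 0 &
       exists y', cdiff Y i y' = f (i + 1) x - y).

Definition stalk_ob (M : fgmod) (i : int) : fgmod := if i == 0 then M else mod0.

Lemma stalk_bounded M :
  exists n : int, forall i, n < `|i| -> is_zero (stalk_ob M i).
Proof.
exists 0 => i; rewrite normr_gt0 /stalk_ob => /negPf -> x.
by rewrite [LHS]thinmx0.
Qed.

Definition stalk (M : fgmod) : bcomplex :=
  @BComplex (stalk_ob M) (fun i => \0) (fun i x => erefl) (stalk_bounded M).

Section Shift.
Variable X : bcomplex.

Let d i (x : X (i + 1)) : X (i + 1 + 1) := - cdiff X (i + 1) x.

Let dL i : linear (@d i).
Proof. by move=> a x y; rewrite /d linearP opprD scalerN. Qed.

Lemma shift_bounded : exists n : int, forall i, n < `|i| -> is_zero (X (i + 1)).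
Proof.
have [n nP] := cbounded X; exists (n + 1) => i ni; apply: nP.
rewrite -(ltrD2r 1) (lt_le_trans ni) //.
by rewrite -[X in `|X| <= _](addrK 1) (le_trans (ler_normB _ _)) ?normr1.
Qed.

Lemma shiftK i x : linear_of (@dL (i + 1)) (linear_of (@dL i) x) = 0.
Proof. by rewrite /= /d linearN opprK cdiffK. Qed.

Definition shift : bcomplex :=
  @BComplex (fun i => X (i + 1)) (fun i => linear_of (@dL i)) shiftK
    shift_bounded.
End Shift.

Section Sum.
Variables X Y : bcomplex.

Let d i (p : dsum (X i) (Y i)) : dsum (X (i + 1)) (Y (i + 1)) :=
  (cdiff X i p.1, cdiff Y i p.2).

Let dL i : linear (@d i).
Proof. by move=> a x y; rewrite /d /= !linearP. Qed.

Lemma csum_bounded :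
  exists n : int, forall i, n < `|i| -> is_zero (dsum (X i) (Y i)).
Proof.
have [m mP] := cbounded X; have [n nP] := cbounded Y.
exists (Num.max m n) => i; rewrite gt_max => /andP[/mP X0 /nP Y0] [x y].
by rewrite (X0 x) (Y0 y).
Qed.

Lemma csumK i x : linear_of (@dL (i + 1)) (linear_of (@dL i) x) = 0.
Proof. by rewrite /= /d /= !cdiffK. Qed.

Definition csum : bcomplex :=
  @BComplex (fun i => dsum (X i) (Y i)) (fun i => linear_of (@dL i)) csumK
    csum_bounded.
End Sum.

Section Cone.
Variables (X Y : bcomplex) (f : cmap X Y).

Let d i (p : dsum (X (i + 1)) (Y i)) : dsum (X (i + 1 + 1)) (Y (i + 1)) :=
  (- cdiff X (i + 1) p.1, f (i + 1) p.1 + cdiff Y i p.2).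

Let dL i : linear (@d i).
Proof.
move=> a [x1 x2] [y1 y2]; apply/pair_equal_spec => /=; split.
  by rewrite linearP opprD scalerN.
by rewrite !linearP scalerDr addrACA.
Qed.

Lemma cone_bounded :
  exists n : int, forall i, n < `|i| -> is_zero (dsum (X (i + 1)) (Y i)).
Proof. by have [n nP] := csum_bounded (shift X) Y; exists n. Qed.

Lemma coneK i x : linear_of (@dL (i + 1)) (linear_of (@dL i) x) = 0.
Proof.
rewrite /= /d /= linearN opprK cdiffK linearN linearD cdiffK addr0 cmapC.
by rewrite addNr.
Qed.

Definition cone : bcomplex :=
  @BComplex (fun i => dsum (X (i + 1)) (Y i)) (fun i => linear_of (@dL i))
    coneK cone_bounded.
End Cone.

(* R-perf, the thick subcategory of D^b(R-mod) generated by R. *)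
Inductive perfect : bcomplex -> Prop :=
| perfect_regular : perfect (stalk regmod)
| perfect_qi X Y (f : cmap X Y) : quasi_iso f -> perfect X -> perfect Y
| perfect_qi' X Y (f : cmap X Y) : quasi_iso f -> perfect Y -> perfect X
| perfect_shift X : perfect X -> perfect (shift X)
| perfect_unshift X : perfect (shift X) -> perfect X
| perfect_cone X Y (f : cmap X Y) : perfect X -> perfect Y -> perfect (cone f)
| perfect_summand X Y : perfect (csum X Y) -> perfect X.

(* Isomorphism in D^b(R-mod)/R-perf: as R-perf is thick, the isomorphisms of
   the quotient are the roofs both legs of which have a cone in R-perf. *)
Definition quotient_iso (X Y : bcomplex) : Prop :=
  exists (W : bcomplex) (s : cmap W X) (t : cmap W Y),
    perfect (cone s) /\ perfect (cone t).

(* The distinguished triangles of the quotient are those isomorphic to the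
   image of a cone triangle X' -> Y' -> cone f -> X'[1]; this is the existence
   of such a triangle with vertices X, Y, Z. *)
Definition quotient_triangle (X Y Z : bcomplex) : Prop :=
  exists (X' Y' : bcomplex) (f : cmap X' Y'),
    [/\ quotient_iso X' X, quotient_iso Y' Y & quotient_iso (cone f) Z].

(* The homomorphisms of the stable category are taken modulo those that factor
   through a f.g. projective module. *)

Definition stably_eq (M N : fgmod) (f g : M -> N) : Prop :=
  exists (P : fgmod) (a : {linear M -> P}) (b : {linear P -> N}),
    projective P /\ forall x, f x - g x = b (a x).

Definition stable_iso (M N : fgmod) : Prop :=
  exists (f : {linear M -> N}) (g : {linear N -> M}),
    stably_eq (g \o f) idfun /\ stably_eq (f \o g) idfun.

Definition stable_summand (M N : fgmod) : Prop :=
  exists Z : fgmod, stable_iso (dsum M Z) N.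

(* The triangulated structure of the stable category, transported along the
   functor M |-> stalk M to D^b(R-mod)/R-perf. *)
Definition stable_shift (M N : fgmod) : Prop :=
  quotient_iso (stalk N) (shift (stalk M)).

Definition stable_triangle (M1 M M2 : fgmod) : Prop :=
  quotient_triangle (stalk M1) (stalk M) (stalk M2).

(* Full subcategories of the stable category are predicates on its objects. *)
Inductive generated (I : fgmod -> Prop) : fgmod -> Prop :=
| gen_in M : I M -> generated I M
| gen_zero : generated I mod0
| gen_sum M N : generated I M -> generated I N -> generated I (dsum M N)
| gen_summand M N : stable_summand M N -> generated I N -> generated I M
| gen_shift M N : stable_shift M N -> generated I M -> generated I N
| gen_unshift M N : stable_shift M N -> generated I N -> generated I M.

Definition star (I1 I2 : fgmod -> Prop) (M : fgmod) : Prop :=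
  exists M1 M2, [/\ I1 M1, I2 M2 & stable_triangle M1 M M2].

Definition diamond (I1 I2 : fgmod -> Prop) : fgmod -> Prop :=
  generated (star I1 I2).

Fixpoint generated_in (I : fgmod -> Prop) (i : nat) : fgmod -> Prop :=
  if i is j.+1 then diamond (generated_in I j) (generated I)
  else fun M => stable_iso M mod0.

Definition stable_dim : \bar int := least (fun d =>
  exists M : fgmod, forall N : fgmod, generated_in (eq M) d.+1 N).

Definition self_injective : Prop := injective_module R^o.

End FinGenModules.

Section Algebra.
Variables (k : fieldType) (A : falgType k).

(* Left ideals of A are k-subspaces, as k maps to the center of A. *)
Definition left_ideal (U : {vspace A}) : Prop :=
  forall a x, x \in U -> a * x \in U.

Definition minimal_left_ideal (U : {vspace A}) : Prop :=
  [/\ left_ideal U, U <> 0%VS &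
      forall V, left_ideal V -> (V <= U)%VS -> V = 0%VS \/ V = U].

Definition maximal_left_ideal (U : {vspace A}) : Prop :=
  [/\ left_ideal U, U <> fullv &
      forall V, left_ideal V -> (U <= V)%VS -> V = U \/ V = fullv].

(* A is, as a left module, a direct sum of simple modules. *)
Definition semisimple : Prop :=
  exists n (S : 'I_n -> {vspace A}),
    [/\ forall i, minimal_left_ideal (S i),
        directv (\sum_i S i)%VS & (\sum_i S i)%VS = fullv].

Definition jacobson : A -> Prop :=
  fun x => forall U, maximal_left_ideal U -> x \in U.

Definition ideal_mul (I J : A -> Prop) : A -> Prop := fun x =>
  exists n (a b : 'I_n -> A),
    (forall i, I (a i) /\ J (b i)) /\ x = \sum_i a i * b i.

Definition ideal_pow (I : A -> Prop) (n : nat) : A -> Prop :=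
  iter n (ideal_mul I) (fun=> True).

Definition loewy_length : \bar int :=
  least (fun i => forall x, ideal_pow jacobson i x -> x = 0).

End Algebra.

(* Main.v *)
Require Import Defs.
From HB Require Import structures.
From mathcomp Require Import all_boot all_order all_algebra all_field.
From mathcomp Require Import boolp constructive_ereal.
Import Order.TTheory GRing.Theory Num.Theory.
Local Open Scope ring_scope.

(** The three inequalities have independent proofs.

    Loewy length against representation dimension. If J^n = 0, the module
    M = A/J + A/J^2 + ... + A/J^n works for i = n, and n is at least 2 because
    A is not semisimple. Maps from A/J^j to L are the elements of L killed by
    J^j, so a surjection X -> L with X in add(M) is a right approximation as
    soon as it is onto at each level of the socle series. If J^m L = 0, the
    terms A/J^j with j < m can be chosen freely, and a projective cover over
    A/J^m takes care of the quotient of L by its elements killed by J^(m-1);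
    minimality of the cover makes J^(m-1) kill the kernel
    ([resolved_killed]). This gives a resolution of length m - 1, and one step
    is saved because self-injectivity splits off from any L a projective
    summand with a complement killed by J^(n-1)
    ([projective_injective_split]).

    The coresolutions come from the resolutions by a comparison argument which
    is the equality of the left and right global dimensions of End(M) in disguise
    ([approx_factor]): the m-th cokernel of a coresolution by left
    approximations is in add(M) once all modules have resolutions of length m.
    That left approximations are injective needs every module to be cogenerated
    by A. For left self-injective A this is a pigeonhole on simple modules,
    replaced here by a statement about two-sided ideals: I |-> l(soc(A) I) is
    strictly antitone on the ideals containing J, so it leaves no room for J
    below the image of a longest chain, whence l(soc A) = J
    ([regular_cogenerator]).

    Representation dimension against weak representation dimension. A
    resolution is a complex with a single cohomology module.

    Weak representation dimension against the stable category. Let C be a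
    complex with terms in add(M) whose only cohomology is H in degree 0. Adding
    the free modules of the start of a projective resolution of H to the terms
    of negative degree makes C exact, except that the leftmost kernel becomes
    a syzygy of H ([chain_generated]). Cutting the resulting exact sequence
    into short exact ones, each of which is a stable triangle, builds that
    syzygy, hence H, from M in as many steps as C has terms
    ([right_chain_generated]). *)

Set Implicit Arguments.
Unset Strict Implicit.
Unset Printing Implicit Defensive.

(** * Submodules and quotient modules *)

Definition submod (R : nzRingType) (M : lmodType R) (U : M -> Prop) : Prop :=
  U 0 /\ forall a x y, U x -> U y -> U (a *: x + y).

Section SubQuotient.
Local Open Scope quotient_scope.
Variables (R : nzRingType) (M : lmodType R) (U : M -> Prop).

Definition submod_pred (sU : submod U) : {pred M} := fun x => `[< U x >].

Variable sU : submod U.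
Notation P := (submod_pred sU).

Lemma submod_predP x : reflect (U x) (x \in P).
Proof. exact: asboolP. Qed.

Lemma submod_pred_closed : submod_closed P.
Proof.
have [U0 UD] := sU; split; first exact/submod_predP.
by move=> a x y /submod_predP ux /submod_predP uy; apply/submod_predP/UD.
Qed.

HB.instance Definition _ := GRing.isSubmodClosed.Build R M P submod_pred_closed.

Definition submod_type := {x : M | x \in P}.
HB.instance Definition _ := SubChoice.on submod_type.
HB.instance Definition _ := [SubChoice_isSubLmodule of submod_type by <:].

Lemma submod_exists : exists (K : lmodType R) (i : {linear K -> M}),
  injective i /\ forall x, U x <-> exists z, i z = x.
Proof.
exists submod_type, (val : {linear submod_type -> M}).
split; first exact: val_inj.
move=> x; split=> [Ux|[z <-]]; last exact/submod_predP/(valP z).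
have Px : x \in P by apply/submod_predP.
by exists (exist _ x Px).
Qed.

Notation Q := (@Quotient.quot M P).
Definition quot_scale (a : R) (q : Q) : Q := \pi_Q (a *: repr q).

Let piE x y : \pi_Q x = \pi_Q y <-> U (x - y).
Proof.
by split=> [/eqP|] h; [apply/submod_predP|apply/eqP];
  rewrite ?Quotient.idealrBE // -Quotient.idealrBE; apply/submod_predP.
Qed.

Let UZ a x : U x -> U (a *: x).
Proof. by move=> h; rewrite -[_ *: _]addr0; apply: sU.2 => //; case: sU. Qed.

Let pi_scale a x : quot_scale a (\pi_Q x) = \pi_Q (a *: x).
Proof. by apply/piE; rewrite -scalerBr; apply: UZ; apply/piE; exact: reprK. Qed.

Let piD x y : \pi_Q (x + y) = \pi_Q x + \pi_Q y.
Proof. exact: raddfD. Qed.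

Let quotE (v : Q) : exists x, v = \pi_Q x.
Proof. by exists (repr v); rewrite reprK. Qed.

Let scaleA a b v : quot_scale a (quot_scale b v) = quot_scale (a * b) v.
Proof. by have [x ->] := quotE v; rewrite !pi_scale scalerA. Qed.
Let scale1 : left_id 1 quot_scale.
Proof. by move=> v; have [x ->] := quotE v; rewrite pi_scale scale1r. Qed.
Let scaleDr : right_distributive quot_scale +%R.
Proof.
move=> a u v; have [x ->] := quotE u; have [y ->] := quotE v.
by rewrite -piD !pi_scale scalerDr piD.
Qed.
Let scaleDl v : {morph quot_scale^~ v : a b / a + b}.
Proof.
by move=> a b; have [x ->] := quotE v; rewrite !pi_scale scalerDl piD.
Qed.

Definition quot_type : Type := Q.
HB.instance Definition _ := GRing.Zmodule.on quot_type.
HB.instance Definition _ :=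
  GRing.Zmodule_isLmodule.Build R quot_type scaleA scale1 scaleDr scaleDl.

Lemma quotient_exists : exists (N : lmodType R) (p : {linear M -> N}),
  (forall y, exists x, p x = y) /\ forall x, p x = 0 <-> U x.
Proof.
have pL : linear (\pi_Q : M -> quot_type).
  by move=> a x y; rewrite piD -pi_scale.
exists quot_type, (linear_of pL); split=> [y|x]; first by exists (repr y); exact: reprK.
have p0 : linear_of pL 0 = 0 by rewrite linear0.
by rewrite -p0 /= -[x in U x]subr0; exact: piE.
Qed.
End SubQuotient.

(** * Linear maps, retracts and add(M) *)

Section LinearMaps.
Variable R : nzRingType.

Section Combinators.
Variables T X Y : lmodType R.

Definition lpair_fun (f : {linear T -> X}) (g : {linear T -> Y}) t := (f t, g t).
Lemma lpair_linear f g : linear (lpair_fun f g).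
Proof. by move=> a x y; rewrite /lpair_fun !linearP. Qed.
Definition lpair f g : {linear T -> (X * Y)%type} := linear_of (lpair_linear f g).

Definition lsum_fun (f : {linear X -> T}) (g : {linear Y -> T}) p := f p.1 + g p.2.
Lemma lsum_linear f g : linear (lsum_fun f g).
Proof. by move=> a x y; rewrite /lsum_fun !linearP scalerDr addrACA. Qed.
Definition lsum f g : {linear (X * Y)%type -> T} := linear_of (lsum_linear f g).
End Combinators.

Definition surj (M N : Type) (f : M -> N) := forall y, exists x, f x = y.

Lemma lin_inj (M N : lmodType R) (f : {linear M -> N}) :
  (forall x, f x = 0 -> x = 0) -> injective f.
Proof.
move=> h x y /eqP; rewrite -subr_eq0 -linearB => /eqP /h /eqP.
by rewrite subr_eq0 => /eqP.
Qed.

Lemma inj_lin0 (M N : lmodType R) (f : {linear M -> N}) x :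
  injective f -> f x = 0 -> x = 0.
Proof. by move=> fi h; apply: fi; rewrite linear0. Qed.

Lemma lin_factor (M N T : lmodType R) (p : {linear M -> N}) (f : {linear M -> T}) :
  surj p -> (forall x, p x = 0 -> f x = 0) ->
  exists g : {linear N -> T}, forall x, g (p x) = f x.
Proof.
move=> /choice[s sK] h.
have E x y : p x = p y -> f x = f y.
  move=> /eqP; rewrite -subr_eq0 -linearB => /eqP /h /eqP.
  by rewrite linearB subr_eq0 => /eqP.
have gL : linear (f \o s).
  by move=> a x y; rewrite /= -linearP; apply: E; rewrite linearP !sK.
by exists (linear_of gL) => x /=; apply: E; rewrite sK.
Qed.

Lemma lin_lift (K M T : lmodType R) (i : {linear K -> M}) (f : {linear T -> M}) :
  injective i -> (forall t, exists z, i z = f t) ->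
  exists g : {linear T -> K}, forall t, i (g t) = f t.
Proof.
move=> ii /choice[g gE].
have gL : linear g by move=> a x y; apply: ii; rewrite linearP !gE linearP.
by exists (linear_of gL).
Qed.

Lemma inj_surj_bij (M N : lmodType R) (f : {linear M -> N}) :
  injective f -> surj f -> bijective f.
Proof.
move=> fi /choice[g gK]; exists g => [x|]; last exact: gK.
by apply: fi; rewrite gK.
Qed.

Lemma lin_inv (M N : lmodType R) (f : {linear M -> N}) : bijective f ->
  exists g : {linear N -> M}, cancel f g /\ cancel g f.
Proof.
case=> g fK gK.
have gL : linear g by move=> a x y; apply: (can_inj fK); rewrite linearP !gK.
by exists (linear_of gL).
Qed.

Lemma ker_submod (M N : lmodType R) (f : {linear M -> N}) :
  submod (fun x => f x = 0).
Proof.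
split=> [|a x y fx fy]; first exact: linear0.
by rewrite linearP fx fy scaler0 addr0.
Qed.

Lemma im_submod (M N : lmodType R) (f : {linear M -> N}) :
  submod (fun y => exists x, f x = y).
Proof.
split=> [|a _ _ [x <-] [y <-]]; first by exists 0; exact: linear0.
by exists (a *: x + y); rewrite linearP.
Qed.

Lemma preim_submod (M N : lmodType R) (f : {linear M -> N}) U :
  submod U -> submod (fun x => U (f x)).
Proof.
move=> [U0 UD]; split=> [|a x y ux uy]; first by rewrite linear0.
by rewrite linearP; exact: UD.
Qed.

Section Submod.
Variables (M : lmodType R) (U : M -> Prop).
Hypothesis sU : submod U.
Lemma submod0 : U 0. Proof. by case: sU. Qed.
Lemma submodZ a x : U x -> U (a *: x).
Proof. by move=> h; rewrite -[_ *: _]addr0; apply: sU.2 => //; case: sU. Qed.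
Lemma submodD x y : U x -> U y -> U (x + y).
Proof. by move=> ux uy; rewrite -[x]scale1r; apply: sU.2. Qed.
Lemma submodN x : U x -> U (- x).
Proof. by move=> ux; rewrite -scaleN1r; apply: submodZ. Qed.
Lemma submodB x y : U x -> U y -> U (x - y).
Proof. by move=> ux uy; apply: submodD => //; apply: submodN. Qed.
Lemma submod_sum (I : finType) (F : I -> M) : (forall i, U (F i)) -> U (\sum_i F i).
Proof. by move=> h; elim/big_ind: _ => [|x y|i _] //; [exact: submod0|exact: submodD]. Qed.
End Submod.

Definition meet (M : lmodType R) (U V : M -> Prop) x := U x /\ V x.
Definition join (M : lmodType R) (U V : M -> Prop) x :=
  exists u v, [/\ U u, V v & x = u + v].

Lemma meet_submod (M : lmodType R) (U V : M -> Prop) :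
  submod U -> submod V -> submod (meet U V).
Proof.
move=> [U0 UD] [V0 VD]; split=> // a x y [ux vx] [uy vy].
by split; [exact: UD|exact: VD].
Qed.

Lemma join_submod (M : lmodType R) (U V : M -> Prop) :
  submod U -> submod V -> submod (join U V).
Proof.
move=> [U0 UD] [V0 VD]; split; first by exists 0, 0; rewrite addr0.
move=> a _ _ [u [v [uu vv ->]]] [u' [v' [uu' vv' ->]]].
exists (a *: u + u'), (a *: v + v'); split; [exact: UD|exact: VD|].
by rewrite scalerDr addrACA.
Qed.

Lemma joinl (M : lmodType R) (U V : M -> Prop) x :
  submod V -> U x -> join U V x.
Proof. by move=> [V0 _] ux; exists x, 0; rewrite addr0. Qed.

Lemma joinr (M : lmodType R) (U V : M -> Prop) x :
  submod U -> V x -> join U V x.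
Proof. by move=> [U0 _] ux; exists 0, x; rewrite add0r. Qed.

Definition multiples (M : lmodType R) (x y : M) := exists a, y = a *: x.
Lemma multiples_submod (M : lmodType R) (x : M) : submod (multiples x).
Proof.
split; first by exists 0; rewrite scale0r.
move=> a _ _ [b ->] [c ->]; exists (a * b + c).
by rewrite scalerDl scalerA.
Qed.
Lemma multiples_id (M : lmodType R) (x : M) : multiples x x.
Proof. by exists 1; rewrite scale1r. Qed.

Lemma act_linear (M : lmodType R) (x : M) : linear (fun a : R^o => a *: x).
Proof. by move=> a b c; rewrite scalerDl scalerA. Qed.
Definition act (M : lmodType R) (x : M) : {linear R^o -> M} :=
  linear_of (act_linear x).

Definition retract (X Y : lmodType R) :=
  exists (s : {linear X -> Y}) (r : {linear Y -> X}), forall x, r (s x) = x.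

Lemma retract_refl X : retract X X.
Proof. by exists idfun, idfun. Qed.

Lemma retract_trans Y X Z : retract X Y -> retract Y Z -> retract X Z.
Proof.
move=> [s [r rs]] [s' [r' rs']]; exists (s' \o s), (r \o r') => x /=.
by rewrite rs'.
Qed.

Lemma retract_prod X Y X' Y' : retract X X' -> retract Y Y' ->
  retract (X * Y)%type (X' * Y')%type.
Proof.
move=> [s [r rs]] [s' [r' rs']].
exists (lpair (s \o fst) (s' \o snd)), (lpair (r \o fst) (r' \o snd)).
by case=> x y; rewrite /= /lpair_fun /= /lpair_fun /= rs rs'.
Qed.

Lemma retract_iso X Y : module_iso X Y -> retract X Y.
Proof. by move=> [f /lin_inv[g [fK gK]]]; exists f, g. Qed.

Lemma retract_injective X Y : retract X Y -> injective_module Y ->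
  injective_module X.
Proof.
move=> [s [r rs]] iY M N g h gi.
have [l lE] := iY M N g (s \o h) gi.
by exists (r \o l) => m /=; rewrite lE /= rs.
Qed.

Lemma injective_prod (X Y : lmodType R) : injective_module X ->
  injective_module Y -> injective_module (X * Y)%type.
Proof.
move=> iX iY M N g h gi.
have [l lE] := iX M N g (fst \o h) gi.
have [l' lE'] := iY M N g (snd \o h) gi.
by exists (lpair l l') => m; rewrite /= /lpair_fun lE lE' /=; case: (h m).
Qed.

Lemma projective_regular : projective R^o.
Proof.
move=> M N g h gs; have [x xE] := gs (h 1).
exists (act x) => p /=; rewrite linearZ /= xE -linearZ /=.
by congr (h _); exact: mulr1.
Qed.

Lemma projective_prod (X Y : lmodType R) : projective X -> projective Y ->
  projective (X * Y)%type.
Proof.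
move=> pX pY M N g h gs.
have [l lE] := pX M N g (h \o lpair idfun \0) gs.
have [l' lE'] := pY M N g (h \o lpair \0 idfun) gs.
exists (lsum l l') => -[x y] /=; rewrite /lsum_fun /= linearD lE lE' /=.
by rewrite -linearD /lpair_fun /=; congr (h (_, _)); rewrite ?addr0 ?add0r.
Qed.

Lemma zero_projective (Z : lmodType R) : is_zero Z -> projective Z.
Proof.
move=> z M N g h gs; exists \0 => p.
by rewrite (z p) !linear0.
Qed.

Lemma zero_injective (Z : lmodType R) : is_zero Z -> injective_module Z.
Proof. by move=> z M N g h gs; exists \0 => p; rewrite (z (h p)) /=. Qed.

Lemma mod0_zero : is_zero (mod0 R).
Proof. by move=> x; exact: thinmx0. Qed.

Lemma mpow_projective n : projective (mpow (regmod R) n).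
Proof.
elim: n => [|n IH]; first exact/zero_projective/mod0_zero.
by apply: projective_prod => //; exact: projective_regular.
Qed.

Lemma mpow_injective n : self_injective R -> injective_module (mpow (regmod R) n).
Proof.
move=> iR; elim: n => [|n IH]; first exact/zero_injective/mod0_zero.
exact: injective_prod.
Qed.

Lemma dsum0 (M : fgmod R) : module_iso M (dsum M (mod0 R)).
Proof.
exists (lpair idfun \0 : {linear M -> dsum M (mod0 R)}).
apply: inj_surj_bij => [x y [] //|[x y]]; exists x.
by rewrite /= /lpair_fun /= (mod0_zero y).
Qed.

(** The universal property of the powers P^n as coproducts, stated so that the
    components of an element never have to be named. *)
Lemma mpow_onto (P : fgmod R) (M : lmodType R) n (f : 'I_n -> {linear P -> M}) :
  exists F : {linear mpow P n -> M},
    (forall i, exists s : {linear P -> mpow P n}, forall p, F (s p) = f i p) /\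
    (forall x, exists c : 'I_n -> P, F x = \sum_i f i (c i)).
Proof.
elim: n f => [|n IH] f.
  by exists \0; split=> [[]//|x]; exists (fun=> 0); rewrite big_ord0.
have [F [F1 F2]] := IH (fun i => f (lift ord0 i)).
exists (lsum (f ord0) F : {linear mpow P n.+1 -> M}); split=> [i|[p x]].
  case: (unliftP ord0 i) => [j ->|->].
    have [s sE] := F1 j.
    exists (lpair \0 s : {linear P -> mpow P n.+1}) => p.
    by rewrite /= /lsum_fun /= linear0 add0r sE.
  exists (lpair idfun \0 : {linear P -> mpow P n.+1}) => p.
  by rewrite /= /lsum_fun /= linear0 addr0.
have [c cE] := F2 x.
exists (fun i => if unlift ord0 i is Some j then c j else p).
rewrite big_ord_recl unlift_none /= /lsum_fun /= cE; congr (_ + _).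
by apply: eq_bigr => i _; rewrite liftK.
Qed.

Lemma mpow_ind (C : lmodType R -> Prop) (P : fgmod R) n :
  C (mod0 R) -> (forall X Y : fgmod R, C X -> C Y -> C (dsum X Y)) -> C P ->
  C (mpow P n).
Proof. by move=> C0 CD CP; elim: n => [|n IH] //=; exact: CD. Qed.

Lemma free_cover (M : fgmod R) :
  exists n (F : {linear mpow (regmod R) n -> M}), surj F.
Proof.
have [n [g gP]] := fg_fin M.
have [F [F1 F2]] := mpow_onto (P := regmod R) (fun i => act (g i)).
exists n, F => x; have [c ->] := gP x.
apply: (submod_sum (im_submod F)) => i; have [s sE] := F1 i.
by exists (s (c i)); rewrite sE.
Qed.

Lemma surj_fg (M : fgmod R) (N : lmodType R) (p : {linear M -> N}) :
  surj p -> finitely_generated N.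
Proof.
move=> ps; have [n [g gP]] := fg_fin M; exists n, (p \o g) => y.
have [x <-] := ps y; have [c ->] := gP x; exists c.
by rewrite linear_sum; apply: eq_bigr => i _; rewrite linearZ.
Qed.

Lemma quotient_fg (M : fgmod R) (U : M -> Prop) : submod U ->
  exists (N : fgmod R) (p : {linear M -> N}), surj p /\ forall x, p x = 0 <-> U x.
Proof.
move=> sU; have [N [p [ps pU]]] := quotient_exists sU.
by exists (FGMod (surj_fg ps)), p.
Qed.

(** Noetherianity in the form in which it is used: submodules of finitely
    generated modules are again objects of the category. *)
Definition noetherian := forall (M : fgmod R) (U : M -> Prop), submod U ->
  exists (K : fgmod R) (i : {linear K -> M}),
    injective i /\ forall x, U x <-> exists z, i z = x.

End LinearMaps.

Section AddOf.
Variable R : nzRingType.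
Hypothesis nR : noetherian R.

(** Summands of finitely generated modules need no chosen complement: the kernel
    of the retraction is one, and it is finitely generated. *)
Lemma direct_summandP (X Y : fgmod R) : direct_summand X Y <-> retract X Y.
Proof.
split=> [[Z iso]|[s [r rs]]].
  apply: retract_trans (retract_iso iso).
  exists (lpair idfun \0 : {linear X -> dsum X Z}), fst.
  by move=> x.
have [Z [i [ii iP]]] := nR (ker_submod r).
exists Z, (lsum s i : {linear dsum X Z -> Y}); apply: inj_surj_bij.
  apply: lin_inj => -[x z]; rewrite /= /lsum_fun /= => E.
  have ri : r (i z) = 0 by apply/iP; exists z.
  have := congr1 r E; rewrite linearD rs ri addr0 linear0 => x0.
  move: E; rewrite x0 linear0 add0r => /(inj_lin0 ii) ->.
  by [].
move=> y; have /iP[z zE] : r (y - s (r y)) = 0 by rewrite linearB rs subrr.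
by exists (r y, z); rewrite /= /lsum_fun /= zE addrC subrK.
Qed.

Lemma add_ofP (M X : fgmod R) :
  add_of M X <-> exists n, retract X (mpow M n).
Proof. by split=> -[n /direct_summandP h]; exists n. Qed.

Lemma mpow_add (M : fgmod R) m n :
  retract (dsum (mpow M m) (mpow M n)) (mpow M (m + n)).
Proof.
elim: m => [|m IH].
  exists (snd : {linear dsum (mpow M 0) (mpow M n) -> mpow M n}).
  exists (lpair \0 idfun : {linear mpow M n -> dsum (mpow M 0) (mpow M n)}).
  by case=> x y /=; rewrite /lpair_fun /= (mod0_zero x).
apply: retract_trans (retract_prod (retract_refl M) IH).
exists (lpair (fst \o fst) (lpair (snd \o fst) snd)
  : {linear dsum (mpow M m.+1) (mpow M n) -> dsum M (dsum (mpow M m) (mpow M n))}).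
exists (lpair (lpair fst (fst \o snd)) (snd \o snd)
  : {linear dsum M (dsum (mpow M m) (mpow M n)) -> dsum (mpow M m.+1) (mpow M n)}).
by case=> [[x y] z].
Qed.

Lemma add_retract (M X Y : fgmod R) : retract X Y -> add_of M Y -> add_of M X.
Proof.
by move=> rXY /add_ofP[n h]; apply/add_ofP; exists n; exact: retract_trans h.
Qed.

Lemma add_id (M : fgmod R) : add_of M M.
Proof. by apply/add_ofP; exists 1%N; exact/retract_iso/dsum0. Qed.

Lemma add_zero (M Z : fgmod R) : is_zero Z -> add_of M Z.
Proof.
move=> z; apply/add_ofP; exists 0%N, \0, \0 => x.
by rewrite (z x) linear0.
Qed.

Lemma add_dsum (M X Y : fgmod R) : add_of M X -> add_of M Y -> add_of M (dsum X Y).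
Proof.
move=> /add_ofP[m hm] /add_ofP[n hn]; apply/add_ofP; exists (m + n)%N.
by apply: retract_trans (mpow_add M m n); exact: retract_prod.
Qed.

Lemma add_mpow (M X : fgmod R) n : add_of M X -> add_of M (mpow X n).
Proof.
move=> h; elim: n => [|n IH]; first exact/add_zero/mod0_zero.
exact: add_dsum.
Qed.

Lemma add_trans (M N X : fgmod R) : add_of M N -> add_of N X -> add_of M X.
Proof.
move=> h /add_ofP[n hn]; apply: add_retract hn _; exact: add_mpow.
Qed.

End AddOf.

(** * Finite dimensionality *)

Section Extremal.
Variables (T : Type) (Q : T -> Prop) (r : T -> nat).

Lemma exists_min : (exists t, Q t) ->
  exists t, Q t /\ forall u, Q u -> (r t <= r u)%N.
Proof.
move=> [t Qt].
have ex : exists n, `[< exists u, Q u /\ r u = n >].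
  by exists (r t); apply/asboolP; exists t.
case: (ex_minnP ex) => n /asboolP[u [Qu <-]] h; exists u; split=> // v Qv.
by apply: h; apply/asboolP; exists v.
Qed.

Lemma exists_max b : (exists t, Q t) -> (forall t, Q t -> r t <= b)%N ->
  exists t, Q t /\ forall u, Q u -> (r u <= r t)%N.
Proof.
move=> [t Qt] bP.
have ex : exists n, `[< exists u, Q u /\ r u = n >].
  by exists (r t); apply/asboolP; exists t.
have bd n : `[< exists u, Q u /\ r u = n >] -> (n <= b)%N.
  by move=> /asboolP[u [/bP h <-]].
case: (ex_maxnP ex bd) => n /asboolP[u [Qu <-]] h; exists u; split=> // v Qv.
by apply: h; apply/asboolP; exists v.
Qed.
End Extremal.

Section FiniteDimension.
Variables (k : fieldType) (A : falgType k).

(** Take a subspace of largest dimension among those contained in P. *)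
Lemma vspace_exists (vT : vectType k) (P : vT -> Prop) :
  P 0 -> (forall c x y, P x -> P y -> P (c *: x + y)) ->
  exists V : {vspace vT}, forall x, x \in V <-> P x.
Proof.
move=> P0 PD.
pose Q (V : {vspace vT}) := forall x, x \in V -> P x.
have ex : exists V, Q V by exists 0%VS => x; rewrite memv0 => /eqP ->.
have bd V : Q V -> (\dim V <= \dim {:vT})%N by move=> _; exact/dimvS/subvf.
have [V [QV Vmax]] := exists_max ex bd; exists V => x; split; first exact: QV.
move=> Px; have QVx : Q (<[x]> + V)%VS.
  move=> _ /memv_addP[_ /vlineP[c ->] [v /QV Pv ->]]; exact: PD.
have /eqP -> : V == (<[x]> + V)%VS by rewrite eqEdim addvSr /= Vmax.
by apply: subvP (addvSl _ _) _ _; exact: memv_line.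
Qed.

Section Rank.
Variable M : fgmod A.

(** Modules over A carry no vector space structure as given; a presentation by a
    power of A lends them the dimension theory of that power. *)
Lemma chart_exists : exists n (pi : {ffun 'I_n -> A} -> M),
  [/\ surj pi, pi 0 = 0 &
      forall (c : k) x y, pi (c *: x + y) = c%:A *: pi x + pi y].
Proof.
have [n [g gP]] := fg_fin M.
exists n, (fun c : {ffun 'I_n -> A} => \sum_i c i *: g i); split.
- move=> x; have [c ->] := gP x; exists [ffun i => c i].
  by apply: eq_bigr => i _; rewrite ffunE.
- by apply: big1 => i _; rewrite ffunE scale0r.
move=> c x y; rewrite scaler_sumr -big_split; apply: eq_bigr => i _ /=.
by rewrite !ffunE scalerDl scalerA mulr_algl.
Qed.

Lemma noetherian_falg_fg (U : M -> Prop) : submod U ->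
  exists n (g : 'I_n -> M), (forall i, U (g i)) /\
    forall x, U x -> exists c : 'I_n -> A, x = \sum_i c i *: g i.
Proof.
move=> sU; have [n [pi [pis pi0 piD]]] := chart_exists.
have [||V VP] := @vspace_exists _ (fun c => U (pi c)).
- by rewrite pi0; exact: submod0.
- by move=> c x y ux uy; rewrite piD; apply: sU.2.
have piS (I : finType) (c : I -> k) (F : I -> {ffun 'I_n -> A}) :
    pi (\sum_i c i *: F i) = \sum_i (c i)%:A *: pi (F i).
  by elim/big_rec2: _ => [|i u v _ h]; [exact: pi0|rewrite piD h].
exists (\dim V), (fun i => pi (vbasis V)`_i); split=> [i|x Ux].
  by apply/VP/vbasis_mem/mem_nth; rewrite size_tuple.
have [c cx] := pis x; have /coord_vbasis E : c \in V by apply/VP; rewrite cx.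
by exists (fun i => (coord (vbasis V) i c)%:A); rewrite -piS -E.
Qed.

(** The rank of U is the dimension of its preimage in a free cover. Strict
    monotonicity is all that is needed from it, since it turns into extremal
    principles for submodules. *)
Lemma rank_exists : exists (r : (M -> Prop) -> nat) (b : nat),
  forall U V : M -> Prop, submod U -> submod V -> (forall x, U x -> V x) ->
  [/\ (r U <= r V)%N, (r V <= b)%N & (r V <= r U)%N -> forall x, V x -> U x].
Proof.
have [n [pi [pis pi0 piD]]] := chart_exists.
have VE (U : M -> Prop) : exists V : {vspace {ffun 'I_n -> A}},
    submod U -> forall c, c \in V <-> U (pi c).
  have [sU|nU] := pselect (submod U); last by exists 0%VS => /nU.
  have [||V VP] := @vspace_exists _ (fun c => U (pi c)); last by exists V.
  - by rewrite pi0; exact: submod0.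
  - by move=> c x y ux uy; rewrite piD; apply: sU.2.
have [W WP] := choice VE.
exists (fun U => \dim (W U)), (\dim {: {ffun 'I_n -> A}}) => U V sU sV UV.
have WUV : (W U <= W V)%VS.
  by apply/subvP => c /(WP _ sU) Uc; apply/(WP _ sV)/UV.
split; [exact: dimvS|exact/dimvS/subvf|move=> le x].
have /eqP E : W U == W V by rewrite eqEdim WUV.
have [c <-] := pis x => /(WP _ sV); rewrite -E => /(WP _ sU). exact.
Qed.

Lemma min_submod (Q : (M -> Prop) -> Prop) :
  (forall U, Q U -> submod U) -> (exists U, Q U) ->
  exists U, Q U /\
    forall V, Q V -> (forall x, V x -> U x) -> forall x, U x -> V x.
Proof.
move=> Qs ex; have [r [b rP]] := rank_exists.
have [U [QU Umin]] := exists_min r ex; exists U; split=> // V QV VU.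
by have [_ _ h] := rP _ _ (Qs _ QV) (Qs _ QU) VU; exact/h/Umin.
Qed.

Lemma max_submod (Q : (M -> Prop) -> Prop) :
  (forall U, Q U -> submod U) -> (exists U, Q U) ->
  exists U, Q U /\
    forall V, Q V -> (forall x, U x -> V x) -> forall x, V x -> U x.
Proof.
move=> Qs ex; have [r [b rP]] := rank_exists.
have bd U : Q U -> (r U <= b)%N.
  by move=> /Qs sU; have [] := rP _ _ sU sU (fun _ h => h).
have [U [QU Umax]] := exists_max ex bd; exists U; split=> // V QV UV.
by have [_ _ h] := rP _ _ (Qs _ QU) (Qs _ QV) UV; exact/h/Umax.
Qed.
End Rank.

Lemma noetherian_falg : noetherian A.
Proof.
move=> M U sU; have [K [i [ii iP]]] := submod_exists sU.
have [n [g [gU gP]]] := noetherian_falg_fg sU.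
have /choice[h hE] : forall j, exists z, i z = g j by move=> j; exact/iP/gU.
have Kf : finitely_generated K.
  exists n, h => z; have /gP[c cE] : U (i z) by apply/iP; exists z.
  exists c; apply: ii; rewrite cE linear_sum; apply: eq_bigr => j _.
  by rewrite linearZ hE.
by exists (FGMod Kf), i.
Qed.

(** Otherwise the kernels of the iterates of f would grow forever. *)
Lemma surj_inj (M : fgmod A) (f : {linear M -> M}) : surj f -> injective f.
Proof.
move=> fs.
pose Q (U : M -> Prop) := submod U /\
  exists n, forall x, U x <-> iter n f x = 0.
have [|U [[sU [n UE]] Umax]] := max_submod (Q := Q) (fun U => @proj1 _ _).
  exists (fun x => x = 0); split; last by exists 0%N.
  exact: (ker_submod (M := M) (N := M) idfun).
have it m : exists g : {linear M -> M}, forall x, g x = iter m f x.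
  elim: m => [|m [g gE]]; first by exists idfun.
  by exists (f \o g) => x /=; rewrite gE.
have its m y : exists x, iter m f x = y.
  elim: m y => [|m IH] y; first by exists y.
  by have [x <-] := fs y; have [z <-] := IH x; exists z.
apply: lin_inj => x fx; have [y yx] := its n x.
have Vy : iter n.+1 f y = 0 by rewrite iterS yx.
suff /UE : U y by rewrite yx.
apply: (Umax (fun x => iter n.+1 f x = 0)) Vy => [|z /UE].
  split; last by exists n.+1.
  have [g gE] := it n.+1; split; first by rewrite -gE linear0.
  by move=> a u v; rewrite -!gE linearP => -> ->; rewrite scaler0 addr0.
by rewrite iterS => ->; exact: linear0.
Qed.

End FiniteDimension.

(** * The Jacobson radical *)

Section Radical.
Variables (k : fieldType) (A : falgType k).
Local Notation J := (@jacobson k A).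
Local Notation Jpow := (ideal_pow J).

Lemma left_ideal_vspace (I : A^o -> Prop) : submod I ->
  exists V : {vspace A}, left_ideal V /\ forall x, x \in V <-> I x.
Proof.
move=> sI; have [||V VP] := @vspace_exists _ A I; first exact: (submod0 sI).
  by move=> c x y Ix Iy; rewrite -mulr_algl; apply: sI.2.
by exists V; split=> // a x /VP Ix; apply/VP; exact: (submodZ sI).
Qed.

Lemma vspace_left_ideal (V : {vspace A}) : left_ideal V ->
  submod (fun x : A^o => x \in V).
Proof.
move=> VL; split; first exact: mem0v.
by move=> a x y Vx Vy; apply: memvD => //; exact: VL.
Qed.

(** Maximal left ideals as predicates; they are the same as those given by
    subspaces because every left ideal is a subspace, see [jacobsonP]. *)
Definition maximal_ideal (I : A^o -> Prop) := [/\ submod I, ~ I 1 &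
  forall I' : A^o -> Prop, submod I' -> (forall x, I x -> I' x) -> ~ I' 1 ->
    forall x, I' x -> I x].

Lemma maximal_ideal_exists (I : A^o -> Prop) : submod I -> ~ I 1 ->
  exists m, maximal_ideal m /\ forall x, I x -> m x.
Proof.
move=> sI I1.
have [|m [[sm [m1 Im]] mmax]] := max_submod (M := regmod A)
  (Q := fun U => submod U /\ (~ U 1 /\ forall x, I x -> U x)) (fun U => @proj1 _ _).
  by exists I.
exists m; split=> //; split=> // I' sI' mI' I'1 x.
by apply: mmax x => //; split=> //; split=> // y /Im /mI'.
Qed.

Lemma maximal_ideal_sum (m : A^o -> Prop) (y : A^o) : maximal_ideal m -> ~ m y ->
  exists b z, m z /\ 1 = b * y + z.
Proof.
move=> [sm m1 mmax] my; apply: contrapT => no; apply: my.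
apply: (mmax (join (multiples y) m)).
- exact: join_submod (multiples_submod y) sm.
- by move=> x mx; apply: joinr mx; exact: multiples_submod.
- by move=> [_ [z [[b ->] mz E]]]; apply: no; exists b, z.
by apply: joinl => //; exact: multiples_id.
Qed.

Lemma jacobsonP x : J x <-> forall m, maximal_ideal m -> m x.
Proof.
split=> [Jx m [sm m1 mmax]|h U [UL Uf Umax]].
  have [V [VL VP]] := left_ideal_vspace sm.
  apply/VP/Jx; split=> // [Vf|W WL VW].
    by apply: m1; apply/VP; rewrite Vf memvf.
  have [W1|W1] := boolP ((1 : A) \in W).
    right; apply/eqP; rewrite eqEsubv subvf; apply/subvP => a _.
    by rewrite -[a]mulr1; exact: WL.
  left; apply/eqP; rewrite eqEsubv VW andbT; apply/subvP => a Wa; apply/VP.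
  apply: (mmax (fun x => x \in W)) Wa; first exact: vspace_left_ideal.
    by move=> b /VP; exact: (subvP VW).
  exact/negP.
apply: (h (fun x => x \in U)); split; first exact: vspace_left_ideal.
  move=> U1; apply: Uf; apply/eqP; rewrite eqEsubv subvf; apply/subvP => a _.
  by rewrite -[a]mulr1; exact: UL.
move=> I sI UI I1 a Ia; have [V [VL VP]] := left_ideal_vspace sI.
have UV : (U <= V)%VS by apply/subvP => b /UI /VP.
have [<-|Vf] := Umax V VL UV; first exact/VP.
by case: I1; apply/VP; rewrite Vf memvf.
Qed.

Lemma J_submod : submod (J : A^o -> Prop).
Proof.
split; first by apply/jacobsonP => m [sm _ _]; exact: (submod0 sm).
move=> a x y /jacobsonP Jx /jacobsonP Jy; apply/jacobsonP => m mm.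
by have [sm _ _] := mm; apply: sm.2; [exact: Jx|exact: Jy].
Qed.

Lemma J_mull (a b : A) : J b -> J (a * b).
Proof. exact: (submodZ J_submod). Qed.

Lemma J_left_inv (a : A) : J a -> exists u, u * (1 - a) = 1.
Proof.
move=> /jacobsonP Ja; apply: contrapT => no.
have [|m [mm Im]] := maximal_ideal_exists (multiples_submod (1 - a : A^o)).
  by move=> [u E]; apply: no; exists u.
have [sm m1 _] := mm; apply: m1; rewrite -[1](subrK a).
by apply: (submodD sm); [exact/Im/multiples_id|exact: Ja].
Qed.

Lemma left_inv_J (a : A) : (forall b, exists u, u * (1 - b * a) = 1) -> J a.
Proof.
move=> h; apply/jacobsonP => m mm; apply: contrapT => ma.
have [b [z [mz E]]] := maximal_ideal_sum mm ma; have [sm m1 _] := mm.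
have [u uE] := h b; apply: m1; rewrite -uE; apply: (submodZ sm).
by rewrite E addrC addKr.
Qed.

(** The characterization of J by left inverses is symmetric: from an inverse of
    1 - b c a one obtains an inverse of 1 - c a b. *)
Lemma J_mulr (a b : A) : J a -> J (a * b).
Proof.
move=> Ja; apply: left_inv_J => c.
have [u] := J_left_inv (J_mull (b * c) Ja) => uE.
exists (1 + c * a * u * b).
rewrite mulrDl mul1r [c * (a * b)]mulrA.
have -> : c * a * u * b * (1 - c * a * b) = c * a * (u * (1 - b * c * a)) * b.
  by rewrite !mulrBr !mulrBl !mulr1 !mulrA.
by rewrite uE mulr1 subrK.
Qed.

Lemma J_right_inv (a : A) : J a -> exists u, (1 - a) * u = 1.
Proof.
move=> Ja; have [u uE] := J_left_inv Ja.
have [v vE] : exists v, v * u = 1.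
  have [v vE] := J_left_inv (J_mull (- u) Ja); exists v.
  suff <- : 1 - - u * a = u by [].
  by rewrite mulNr opprK -uE mulrBr mulr1 subrK.
exists u; suff -> : 1 - a = v by [].
by rewrite -[1 - a]mul1r -{1}vE -mulrA uE mulr1.
Qed.

Lemma ideal_mul_add (I I' : A -> Prop) x y :
  ideal_mul I I' x -> ideal_mul I I' y -> ideal_mul I I' (x + y).
Proof.
move=> [m [a [b [ab ->]]]] [n [c [d [cd ->]]]].
exists (m + n)%N, (fun i => match split i with inl j => a j | inr j => c j end),
  (fun i => match split i with inl j => b j | inr j => d j end).
split=> [i|]; first by case: (split i) => j.
rewrite big_split_ord; congr (_ + _); apply: eq_bigr => i _.
  by rewrite (unsplitK (inl i)).
by rewrite (unsplitK (inr i)).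
Qed.

Lemma ideal_mul_sum (I I' : A -> Prop) (T : finType) (F : T -> A) :
  (forall i, ideal_mul I I' (F i)) -> ideal_mul I I' (\sum_i F i).
Proof.
move=> h; elim/big_ind: _ => [|x y|i _] //; last exact: ideal_mul_add.
by exists 0%N, (fun=> 0), (fun=> 0); rewrite big_ord0; split=> // -[].
Qed.

Lemma ideal_mul1 (I I' : A -> Prop) a b : I a -> I' b -> ideal_mul I I' (a * b).
Proof. by move=> Ia Ib; exists 1%N, (fun=> a), (fun=> b); rewrite big_ord1. Qed.

Lemma ideal_mull (I I' : A -> Prop) c x : (forall a, I a -> I (c * a)) ->
  ideal_mul I I' x -> ideal_mul I I' (c * x).
Proof.
move=> h [n [a [b [ab ->]]]]; exists n, (fun i => c * a i), b.
split=> [i|]; first by have [ai bi] := ab i; split=> //; exact: h.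
by rewrite mulr_sumr; apply: eq_bigr => i _; rewrite mulrA.
Qed.

Lemma ideal_mulr (I I' : A -> Prop) c x : (forall b, I' b -> I' (b * c)) ->
  ideal_mul I I' x -> ideal_mul I I' (x * c).
Proof.
move=> h [n [a [b [ab ->]]]]; exists n, a, (fun i => b i * c).
split=> [i|]; first by have [ai bi] := ab i; split=> //; exact: h.
by rewrite mulr_suml; apply: eq_bigr => i _; rewrite mulrA.
Qed.

Lemma Jpow_mull i (c a : A) : Jpow i a -> Jpow i (c * a).
Proof.
by case: i => [|i] //=; apply: ideal_mull => b; exact: J_mull.
Qed.

Lemma Jpow_mulr i (c a : A) : Jpow i a -> Jpow i (a * c).
Proof.
elim: i c a => [|i IH] c a //=; apply: ideal_mulr => b; exact: IH.
Qed.

Lemma Jpow_submod i : submod (Jpow i : A^o -> Prop).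
Proof.
case: i => [|i] //; split=> [|a x y jx jy].
  by exists 0%N, (fun=> 0), (fun=> 0); rewrite big_ord0; split=> // -[].
by apply: ideal_mul_add => //; exact: (Jpow_mull (i := i.+1)).
Qed.

Lemma Jpow_leS i a : Jpow i.+1 a -> Jpow i a.
Proof.
move=> [n [c [d [cd ->]]]]; apply: (submod_sum (Jpow_submod i)) => j.
by apply: Jpow_mull; case: (cd j).
Qed.

Lemma Jpow_le i j a : (i <= j)%N -> Jpow j a -> Jpow i a.
Proof.
move=> /subnK <-; elim: (j - i)%N => [|d IH] //.
by rewrite addSn => /Jpow_leS.
Qed.

Lemma Jpow1 a : J a -> Jpow 1 a.
Proof. by move=> Ja; rewrite -[a]mulr1; exact: ideal_mul1. Qed.

Lemma Jpow1E a : Jpow 1 a -> J a.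
Proof.
move=> [n [c [d [cd ->]]]]; apply: (submod_sum J_submod) => i.
by apply: J_mulr; case: (cd i).
Qed.

Lemma Jpow_mulJ i a b : Jpow i a -> J b -> Jpow i.+1 (a * b).
Proof.
elim: i a => [|i IH] a; first by move=> _ Jb; exact/Jpow1/J_mull.
move=> [n [c [d [cd ->]]]] Jb; rewrite mulr_suml; apply: ideal_mul_sum => j.
by have [cj dj] := cd j; rewrite -mulrA; apply: ideal_mul1 => //; exact: IH.
Qed.

(** The i-th term of the socle series, which is also the image of Hom(A/J^i, M)
    under evaluation at 1. *)
Definition killed (M : lmodType A) i (x : M) := forall a, Jpow i a -> a *: x = 0.

Lemma killed_submod (M : lmodType A) i : submod (@killed M i).
Proof.
split=> [a _|a x y kx ky b jb]; first exact: scaler0.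
by rewrite scalerDr scalerA kx ?ky ?addr0 //; exact: Jpow_mulr.
Qed.

Lemma killed_le (M : lmodType A) i j (x : M) : (i <= j)%N ->
  killed i x -> killed j x.
Proof. by move=> le kx a ja; apply: kx; exact: Jpow_le le _. Qed.

Lemma killed0 (M : lmodType A) (x : M) : killed 0 x -> x = 0.
Proof. by move=> h; rewrite -[x]scale1r; exact: h. Qed.

Lemma killed1 (M : lmodType A) (x : M) :
  killed 1 x <-> forall a, J a -> a *: x = 0.
Proof. by split=> h a Ja; apply: h; [exact: Jpow1|exact: Jpow1E]. Qed.

Lemma killedS_l (M : lmodType A) i (x : M) b :
  killed i.+1 x -> Jpow i b -> killed 1 (b *: x).
Proof.
by move=> kx jb; apply/killed1 => a Ja; rewrite scalerA; apply/kx/ideal_mul1.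
Qed.

Lemma killed_lin (M N : lmodType A) (f : {linear M -> N}) i x :
  killed i x -> killed i (f x).
Proof. by move=> kx a ja; rewrite -linearZ kx // linear0. Qed.

Lemma killed_inj (M N : lmodType A) (f : {linear M -> N}) i x : injective f ->
  killed i (f x) -> killed i x.
Proof. by move=> fi kx a ja; apply: (inj_lin0 fi); rewrite linearZ; exact: kx. Qed.

Lemma killed_pair (M N : lmodType A) i (x : M) (y : N) :
  killed i x -> killed i y -> killed i (x, y).
Proof. by move=> kx ky a ja; apply/pair_equal_spec; rewrite kx // ky. Qed.

(** Complements in A/J exist because J is an intersection of maximal ideals: if a
    minimal supplement W of I met I outside of J, intersecting W with a maximal
    ideal that avoids the common element would give a smaller supplement. *)
Lemma ideal_supplement (I : A^o -> Prop) : submod I ->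
  exists W : A^o -> Prop, [/\ submod W, join I W 1 &
    forall x, I x -> W x -> J x].
Proof.
move=> sI.
have [|W [[sW [i [w [Ii Ww E]]]] Wmin]] := min_submod (M := regmod A)
  (Q := fun W => submod W /\ join I W 1) (fun U => @proj1 _ _).
  exists (fun=> True); split=> //; exists 0, 1; rewrite add0r; split=> //.
  exact: (submod0 sI).
exists W; split=> //; first by exists i, w.
move=> y Iy Wy; apply/jacobsonP => m mm; apply: contrapT => my.
have [b [z [mz bE]]] := maximal_ideal_sum mm my; have [sm m1 _] := mm.
have wz : w = w * b * y + w * z by rewrite -mulrA -mulrDr -bE mulr1.
apply: my; apply: (Wmin (meet W m) _ _ y Wy).2 => [|x []//].
split; first exact: meet_submod.
exists (i + w * b * y), (w * z); split.
- by apply: (submodD sI) => //; exact: (submodZ sI).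
- split; last exact: (submodZ sm).
  have -> : w * z = w - w * b * y by rewrite {2}wz addrC addKr.
  by apply: (submodB sW) => //; exact: (submodZ sW).
by rewrite -addrA -wz.
Qed.

(** A submodule W of T maximal among those meeting U trivially is a complement:
    for x outside of W + U, a supplement of the ideal of all a with a x in W + U
    produces multiples of x by which W could be enlarged. *)
Lemma killed_complement (M : fgmod A) (T U : M -> Prop) :
  submod T -> (forall x, T x -> killed 1 x) ->
  submod U -> (forall x, U x -> T x) ->
  exists W : M -> Prop, [/\ submod W, forall x, W x -> T x,
    forall x, W x -> U x -> x = 0 & forall x, T x -> join W U x].
Proof.
move=> sT Tk sU UT.
have [|W [[sW [WT WU]] Wmax]] := max_submod (Q := fun W : M -> Prop =>
  submod W /\ ((forall x, W x -> T x) /\ forall x, W x -> U x -> x = 0))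
  (fun U => @proj1 _ _).
  exists (fun x => x = 0); split; first exact: (ker_submod (M := M) (N := M) idfun).
  by split=> // x ->; exact: (submod0 sT).
exists W; split=> // x Tx; apply: contrapT => nx.
have sWU := join_submod sW sU.
have sI := preim_submod (act x) sWU.
have [W' [sW' [i [w [Ii Ww E]]] IW']] := ideal_supplement sI.
pose W'' := join W (fun y => exists b, W' b /\ y = b *: x).
have sW'' : submod W''.
  apply: join_submod => //; split.
    by exists 0; rewrite scale0r; split=> //; exact: (submod0 sW').
  move=> a _ _ [b [Wb ->]] [c [Wc ->]]; exists (a * b + c).
  by rewrite scalerDl scalerA; split=> //; exact: sW'.2.
have Ww'' : W (w *: x).
  apply: (Wmax W'') => [|y Wy|]; last first.
  - by apply: (joinr sW); exists w.
  - by exists y, 0; split=> //; [exists 0; rewrite scale0r; split=> //;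
      exact: (submod0 sW')|rewrite addr0].
  split=> //; split=> [_ [y [_ [Wy [b [_ ->]] ->]]]|
                       _ [y [_ [Wy [b [Wb ->]] ->]]] Uyb].
    by apply: (submodD sT); [exact: WT|exact: (submodZ sT)].
  have bx0 : b *: x = 0.
    apply: (Tk x Tx); apply: Jpow1; apply: IW' Wb.
    exists (- y), (y + b *: x); split=> //; first exact: (submodN sW).
    by rewrite addKr.
  by rewrite bx0 addr0 in Uyb *; exact: WU.
apply: nx; rewrite -[x]scale1r E scalerDl; apply: (submodD sWU) => //.
exact: joinl.
Qed.

(** Minimal left ideals are split off one at a time. *)
Lemma jacobson0_semisimple : (forall x, J x -> x = 0) -> semisimple A.
Proof.
move=> J0.
have compl (V S : {vspace A}) : left_ideal V -> left_ideal S -> (S <= V)%VS ->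
    exists W : {vspace A}, [/\ left_ideal W, (S :&: W = 0)%VS & (S + W = V)%VS].
  move=> VL SL SV.
  have [||W [sW WV WS VWS]] := killed_complement (M := regmod A)
    (vspace_left_ideal VL) _ (vspace_left_ideal SL).
  - by move=> x _; apply/killed1 => a /J0 ->; rewrite scale0r.
  - by move=> x; exact: (subvP SV).
  have [W0 [WL WP]] := left_ideal_vspace sW; exists W0; split=> //.
    apply/eqP; rewrite -subv0; apply/subvP => x; rewrite memv_cap memv0.
    by move=> /andP[Sx /WP Wx]; apply/eqP/WS.
  apply/eqP; rewrite eqEsubv; apply/andP; split; apply/subvP => x.
    move=> /memv_addP[s Ss [w /WP /WV Vw ->]]; apply: memvD => //.
    exact: (subvP SV).
  move=> /VWS[w [s [/WP Ww Ss ->]]]; rewrite addrC; exact: memv_add.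
suff main d (V : {vspace A}) : left_ideal V -> (\dim V <= d)%N ->
    exists n (S : 'I_n -> {vspace A}), [/\ forall i, minimal_left_ideal (S i),
      directv (\sum_i S i)%VS & (\sum_i S i)%VS = V].
  by apply: (main (\dim {:A})) => // a x _; exact: memvf.
elim: d V => [|d IH] V VL dV.
  exists 0%N, (fun=> 0%VS); split=> [[]//||].
    by rewrite directvE /= !big_ord0 dimv0.
  by rewrite big_ord0; apply/esym/eqP; rewrite -dimv_eq0 -leqn0.
have [V0|/eqP V0] := eqVneq V 0%VS.
  by apply: IH => //; rewrite V0 dimv0.
have [|S [[SL [S0 SV]] Smin]] := exists_min
  (Q := fun S => left_ideal S /\ (S <> 0%VS /\ (S <= V)%VS))
  (fun S : {vspace A} => \dim S).
  by exists V; split=> //; rewrite subvv.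
have Sm : minimal_left_ideal S.
  split=> // U UL US; have [->|/eqP U0] := eqVneq U 0%VS; [by left|right].
  apply/eqP; rewrite eqEdim US Smin //; split=> //; split=> //.
  exact: subv_trans US SV.
have [W [WL SW SWV]] := compl V S VL SL SV.
have dSW : (\dim S + \dim W = \dim V)%N by rewrite -SWV dimv_disjoint_sum.
have [|n [F [Fm Fd FW]]] := IH W WL.
  rewrite -ltnS (leq_trans _ dV) // -dSW -[X in (X < _)%N]add0n ltn_add2r.
  by rewrite lt0n dimv_eq0; apply/eqP.
exists n.+1, (fun i => if unlift ord0 i is Some j then F j else S).
have E : (\sum_(i < n.+1) if unlift ord0 i is Some j then F j else S)%VS = V.
  rewrite big_ord_recl unlift_none -[RHS]SWV; congr (_ + _)%VS; rewrite -FW.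
  by apply: eq_bigr => i _; rewrite liftK.
split=> // [i|]; first by case: unliftP => [j|] _.
rewrite directvE /= E big_ord_recl unlift_none -dSW -FW.
move: Fd; rewrite directvE /= => /eqP ->; apply/eqP; congr (_ + _)%N.
by apply: eq_bigr => i _; rewrite liftK.
Qed.

Lemma jquot_exists i : exists (P : fgmod A) (u : P),
  [/\ forall y, exists a : A, y = a *: u, forall y : P, killed i y &
      forall (N : lmodType A) (x : N), killed i x ->
        exists f : {linear P -> N}, f u = x].
Proof.
have [P [p [ps pP]]] := quotient_fg (M := regmod A) (Jpow_submod i).
exists P, (p 1); have gen y : exists a : A, y = a *: p 1.
  by have [a <-] := ps y; exists a; rewrite -linearZ; congr (p _); exact/esym/mulr1.
split=> //.
  move=> y; have [b ->] := gen y => a ja; rewrite scalerA -linearZ.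
  by apply/pP; rewrite /= /GRing.scale /= mulr1; exact: Jpow_mulr.
move=> N x kx; have [|f fE] := lin_factor (f := act x) ps.
  by move=> a /pP; exact: kx.
by exists f; rewrite fE /= scale1r.
Qed.

End Radical.

(** * Injective hulls and self-injective algebras *)

Section InjectiveHull.
Variables (k : fieldType) (A : falgType k).

Lemma extend_multiples (M E : lmodType A) (x : M) (y : E) : injective_module E ->
  (forall a : A, a *: x = 0 -> a *: y = 0) ->
  exists f : {linear M -> E}, f x = y.
Proof.
move=> iE xy; have [K [i [ii iP]]] := submod_exists (multiples_submod x).
have [|p pE] := lin_lift (f := act x) ii.
  by move=> a; apply/iP; exists a.
have [z|a pa|h hE] := lin_factor (p := p) (f := act y).
- have [a za] : multiples x (i z) by apply/iP; exists z.
  by exists a; apply: ii; rewrite pE za.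
- by apply: xy; have := pE a; rewrite pa linear0 /= => <-.
have [f fE] := iE _ _ i h ii; exists f.
have <- : act x 1 = x by rewrite /= scale1r.
by rewrite -pE fE hE /= scale1r.
Qed.

(** E is a maximal essential extension of C inside F. With D maximal subject to
    meeting E trivially, extend to F the projection of D + E onto E; its kernel
    is D, so its image is essential over E, hence equal to E. *)
Lemma injective_hull (F : fgmod A) (C : F -> Prop) :
  injective_module F -> submod C ->
  exists (E : F -> Prop) (t : {linear F -> F}),
    [/\ submod E, forall x, C x -> E x, forall x, E (t x),
        forall x, E x -> t x = x &
        forall x, E x -> x <> 0 -> exists a, C (a *: x) /\ a *: x <> 0].
Proof.
move=> iF sC.
have [|E [[sE [CE Eess]] Emax]] := max_submod (Q := fun E : F -> Prop =>
    submod E /\ ((forall x, C x -> E x) /\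
    forall x, E x -> x <> 0 -> exists a, C (a *: x) /\ a *: x <> 0))
  (fun U => @proj1 _ _).
  by exists C; split=> //; split=> // x Cx x0; exists 1; rewrite scale1r.
have [|D [[sD DE] Dmax]] := max_submod (Q := fun D : F -> Prop =>
    submod D /\ forall x, D x -> E x -> x = 0) (fun U => @proj1 _ _).
  by exists (fun x => x = 0); split=> //; exact: (ker_submod (M := F) idfun).
have [KE [iE [iEi iEP]]] := submod_exists sE.
have [KD [iD [iDi iDP]]] := submod_exists sD.
have inj : injective (lsum iE iD).
  apply: lin_inj => -[x y] /eqP; rewrite /= /lsum_fun /= addr_eq0 => /eqP xy.
  have x0 : iE x = 0.
    apply: DE; last by apply/iEP; exists x.
    by rewrite xy; apply: (submodN sD); apply/iDP; exists y.
  move/eqP: xy; rewrite x0 eq_sym oppr_eq0 => /eqP /(inj_lin0 iDi) ->.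
  by rewrite (inj_lin0 iEi x0).
have [t tE] := iF _ _ (lsum iE iD) (lsum iE \0) inj.
have tid x : E x -> t x = x.
  move=> /iEP[z <-]; have := tE (z, 0).
  by rewrite /= /lsum_fun /= linear0 !addr0.
have t0 x : D x -> t x = 0.
  move=> /iDP[z <-]; have := tE (0, z).
  by rewrite /= /lsum_fun /= linear0 !add0r.
have kerD x : t x = 0 -> D x.
  apply: (Dmax (fun x => t x = 0)) => [|//]; split; first exact: ker_submod.
  by move=> y ty /tid <-.
exists E, t; split=> // x.
apply: (Emax (fun y => exists x, t x = y)) => [|y /tid ty|]; last 2 first.
- by exists y.
- by exists x.
split; first exact: im_submod.
split=> [y /CE /tid ty|_ [f <-] f0]; first by exists y.
have [a [d [Dd [Ee e0]]]] : exists a d, D d /\ (E (d + a *: f) /\ d + a *: f <> 0).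
  apply: contrapT => no; apply/f0/t0.
  apply: (Dmax (join D (multiples f))) => [|y Dy|]; last 2 first.
  - by apply: joinl Dy; exact: multiples_submod.
  - by apply: joinr => //; exact: multiples_id.
  split; first exact: join_submod (multiples_submod f).
  move=> _ [d [_ [Dd [a ->] ->]]] Ee; apply: contrapT => e0.
  by apply: no; exists a, d.
have [b [Cb b0]] := Eess _ Ee e0; exists (b * a).
have <- : b *: (d + a *: f) = (b * a) *: t f.
  by rewrite -(tid _ Ee) linearD (t0 _ Dd) add0r linearZ scalerA.
by [].
Qed.

End InjectiveHull.

Section QuasiFrobenius.
Variables (k : fieldType) (A : falgType k).
Local Notation J := (@jacobson k A).
Local Notation Jpow := (ideal_pow J).
Variable n : nat.
Hypothesis iA : self_injective A.
Hypothesis Jn : forall x : A, Jpow n x -> x = 0.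

Lemma killed_top (M : lmodType A) (x : M) : killed n x.
Proof. by move=> a /Jn ->; rewrite scale0r. Qed.

Lemma socle_essential (M : lmodType A) (x : M) : x <> 0 ->
  exists a, killed 1 (a *: x) /\ a *: x <> 0.
Proof.
move=> x0; have [i [ki imin]] := exists_min (Q := fun i => killed i x) id
  (ex_intro _ n (killed_top x)).
case: i ki imin => [/killed0 //|i] ki imin.
apply: contrapT => no; suff /imin : killed i x by rewrite ltnn.
move=> a ja; apply: contrapT => ax; apply: no; exists a; split=> //.
exact: killedS_l ki ja.
Qed.

Let S (s : A) := @killed _ A A^o 1 s.
Let left_ann (X : A -> Prop) (a : A) := forall x, X x -> a * x = 0.

Let S_mull a s : S s -> S (a * s).
Proof. exact: (submodZ (killed_submod _ _)). Qed.

Let S_mulr a s : S s -> S (s * a).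
Proof.
by move=> Ss b jb; have := Ss b jb; rewrite /= /GRing.scale /= mulrA => ->;
  rewrite mul0r.
Qed.

Let right_mul (f : {linear A^o -> A^o}) (x : A) : f x = x * f 1.
Proof. by rewrite -[in LHS](mulr1 x); exact: linearZ. Qed.

(** The socle is annihilated by J on the right as well. On a complement W of the
    part of the socle killed by a, right multiplication by a is injective, so by
    self-injectivity it is undone by some right multiplication by b; then
    1 - a b is invertible and annihilates W. *)
Let SJ0 s a : S s -> J a -> s * a = 0.
Proof.
move=> Ss Ja.
have sS : submod (S : A^o -> Prop) := killed_submod _ _.
have sU := meet_submod sS (ker_submod (act (a : A^o))).
have [||W [sW WS WU SWU]] := killed_complement (M := regmod A) sS _ sU.
- by [].
- by move=> x [].
have [w [u [Ww [Su ua] ->]]] := SWU s Ss.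
suff -> : w = 0 by rewrite add0r.
have [|f fE] := @extend_multiples _ A A^o A^o (w * a) w iA.
  move=> b bwa; apply: WU; first exact: (submodZ sW).
  split; first exact/S_mull/WS.
  by rewrite /= -[RHS]bwa; exact/esym/mulrA.
have [v vE] := J_right_inv (J_mulr (f 1) Ja).
rewrite -[w]mulr1 -vE mulrA mulrBr mulr1.
by have := right_mul f (w * a); rewrite fE mulrA => <-; rewrite subrr mul0r.
Qed.

(** If S a = 0 then right multiplication by 1 - b a is the identity on the
    socle, which is essential; so it is injective, hence invertible. *)
Let S_faithful a : (forall s, S s -> s * a = 0) -> J a.
Proof.
move=> Sa; apply: left_inv_J => b; set x := 1 - b * a.
have [|f fE] := @extend_multiples _ A A^o A^o x 1 iA.
  move=> c cx; apply: contrapT => c0.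
  have c0' : (c : A^o) <> 0 by move=> E; apply: c0; rewrite E scale0r.
  have [d [Sd d0]] := socle_essential c0'; apply: d0.
  have : (d *: (c : A^o)) * x = 0 by rewrite -mulrA [c * x]cx mulr0.
  rewrite mulrBr mulr1 mulrA Sa ?subr0 //; exact: S_mulr.
have xv : x * f 1 = 1 by rewrite -right_mul fE.
exists (f 1).
have vs : surj (act (f 1 : A^o)).
  by move=> z; exists (z * x); rewrite /= /GRing.scale /= -mulrA xv mulr1.
have /= vi := @surj_inj _ _ (regmod A) (act (f 1 : A^o)) vs.
by apply: vi; rewrite /= /GRing.scale /= -mulrA xv mulr1 mul1r.
Qed.

(** A right ideal X is the right annihilator of its left annihilator. If y is
    killed by the annihilator of a basis b of X, then a b |-> a y is well
    defined on A b inside a power of A; an extension to that power expresses y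
    through the entries of b. *)
Let rl_right_ideal (X : A -> Prop) y :
  X 0 -> (forall (c : k) u v, X u -> X v -> X (c *: u + v)) ->
  (forall u c, X u -> X (u * c)) ->
  (forall a, left_ann X a -> a * y = 0) -> X y.
Proof.
move=> X0 XD Xr ann; have [V VP] := @vspace_exists _ A X X0 XD.
have XS (I : finType) (g : I -> A) : (forall i, X (g i)) -> X (\sum_i g i).
  move=> h; elim/big_ind: _ => // u v Xu Xv.
  by rewrite -[u]scale1r; exact: XD.
pose M := {ffun 'I_(\dim V) -> A^o}; pose b := vbasis V.
pose e (i : 'I_(\dim V)) : M := [ffun j => (i == j)%:R].
have [|f fE] := @extend_multiples _ A M A^o [ffun i : 'I_(\dim V) => b`_i] y iA.
  move=> a ab; apply: ann => x /VP /coord_vbasis ->; rewrite mulr_sumr big1 // => i _.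
  have := congr1 (fun h : M => h i) ab; rewrite !ffunE => abi.
  by rewrite -scalerAr [a * _]abi scaler0.
rewrite -fE; have -> : [ffun i : 'I_(\dim V) => b`_i] = \sum_(i < \dim V) (b`_i : A) *: e i :> M.
  apply/ffunP => j; rewrite sum_ffunE ffunE (bigD1 j) //= big1 => [|i ij].
    by rewrite !ffunE eqxx /GRing.scale /= mulr1 addr0.
  by rewrite !ffunE (negPf ij) scaler0.
rewrite linear_sum; apply: XS => i; rewrite linearZ; apply: Xr.
by apply/VP/vbasis_mem/mem_nth; rewrite size_tuple.
Qed.

Let ideal_over_J (I : A -> Prop) := [/\ submod (I : A^o -> Prop),
  forall a b, I a -> I (a * b) & forall a, J a -> I a].

Let SI (I : A -> Prop) := ideal_mul S I.

Let SI_mono (I I' : A -> Prop) : (forall x, I x -> I' x) ->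
  forall x, SI I x -> SI I' x.
Proof.
move=> II x [m [a [b [ab ->]]]]; exists m, a, b; split=> // i.
by have [ai bi] := ab i; split=> //; exact: II.
Qed.

(** A supplement of I provides i in I with x i = x modulo J for x in I. For a
    in I', the product S a lies in S I, so S (a - a i) lies in S J = 0; hence
    a - a i belongs to J. *)
Let SI_sub (I I' : A -> Prop) : ideal_over_J I -> ideal_over_J I' ->
  (forall x, SI I' x -> SI I x) -> forall x, I' x -> I x.
Proof.
move=> [sI Ir JI] [sI' Ir' JI'] sub a Ia.
have [W [sW [i [w [Ii Ww E]]] IW]] := ideal_supplement sI.
rewrite -[a]mulr1 E mulrDr; apply: (submodD sI); first exact: (submodZ sI).
apply: JI; apply: S_faithful => s Ss; rewrite mulrA.
have [m [c [d [cd ->]]]] : SI I (s * a) by apply/sub/ideal_mul1.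
rewrite mulr_suml big1 // => j _; have [cj dj] := cd j.
rewrite -mulrA; apply: SJ0 => //; apply: IW; first exact: Ir.
exact: (submodZ sW).
Qed.

Let F (I : A -> Prop) := left_ann (SI I).

Let F_ideal I : ideal_over_J I -> ideal_over_J (F I).
Proof.
move=> [sI Ir JI]; split.
- split=> [x _|a x y Fx Fy z Sz]; first exact: mul0r.
  by rewrite mulrDl -mulrA Fx // Fy // mulr0 addr0.
- move=> a b Fa x Sx; rewrite -mulrA; apply: Fa; apply: ideal_mull Sx => s.
  exact: S_mull.
move=> a Ja _ [m [c [d [cd ->]]]]; rewrite mulr_sumr big1 // => j _.
have [cj dj] := cd j; rewrite mulrA.
have /killed1 h : @killed _ A A^o 1 (c j) := cj.
by rewrite [a * c j](h a Ja) mul0r.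
Qed.

Let F_anti (I I' : A -> Prop) : (forall x, I x -> I' x) ->
  forall x, F I' x -> F I x.
Proof. by move=> II x Fx y /(SI_mono II); exact: Fx. Qed.

Let F_strict (I I' : A -> Prop) : ideal_over_J I -> ideal_over_J I' ->
  (forall x, F I x -> F I' x) -> forall x, I' x -> I x.
Proof.
move=> iI iI' sub; apply: (SI_sub iI iI') => x Sx; have [sI Ir JI] := iI.
apply: rl_right_ideal.
- by exists 0%N, (fun=> 0), (fun=> 0); rewrite big_ord0; split=> // -[].
- move=> c u v Su Sv; apply: ideal_mul_add => //.
  by rewrite -mulr_algl; apply: ideal_mull Su => s; exact: S_mull.
- by move=> u c; apply: ideal_mulr => b; exact: Ir.
by move=> a /sub Fa; exact: Fa.
Qed.

(** Otherwise take a longest chain of ideals: its image under F is as long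
    and lies above the left annihilator of the socle, so that J can be added at
    the bottom, which makes a longer chain. *)
Let left_ann_socle a : left_ann S a -> J a.
Proof.
move=> Sa; apply: contrapT => Ja.
have [r [b rP]] := rank_exists (regmod A).
pose Q (p : (nat -> A -> Prop) * nat) := (forall i, ideal_over_J (p.1 i)) /\
  forall i, (i < p.2)%N -> (forall x, p.1 i x -> p.1 i.+1 x) /\
                          ~ (forall x, p.1 i.+1 x -> p.1 i x).
have iJ : ideal_over_J J by split=> //; [exact: J_submod|move=> *; exact: J_mulr].
have exQ : exists p, Q p by exists (fun=> J, 0%N).
have bd p : Q p -> (p.2 <= b)%N.
  move=> [idp sp]; have sub i : submod (p.1 i : A^o -> Prop) by have [] := idp i.
  suff h i : (i <= p.2)%N -> (i <= r (p.1 i))%N.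
    apply: leq_trans (h _ (leqnn _)) _.
    by have [] := rP _ _ (sub p.2) (sub p.2) (fun _ h => h).
  elim: i => // i IH ip; have [le nle] := sp i ip.
  have [rle _ h] := rP _ _ (sub i) (sub i.+1) le.
  apply: leq_ltn_trans (IH (ltnW ip)) _; rewrite ltnNge; apply/negP => /h.
  exact: nle.
have [[f m] [[/= idf sf] fmax]] := exists_max exQ bd.
(* J, followed by the images of the chain f in reverse order. *)
pose g i := if i is j.+1 then F (f (m - j)%N) else J.
have /fmax /= : Q (g, m.+1); last by rewrite ltnn.
split=> [[|i]|[|i]] /=; [by []|exact/F_ideal| |].
- move=> _; rewrite subn0; have [_ _ JF] := F_ideal (idf m); split=> // h.
  apply/Ja/h => _ [l [c [d [cd ->]]]]; rewrite mulr_sumr big1 // => j _.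
  by have [cj dj] := cd j; rewrite mulrA Sa ?mul0r.
rewrite ltnS => im; have -> : (m - i = (m - i.+1).+1)%N by rewrite subnSK.
have [|le nle] := sf (m - i.+1)%N; first by rewrite ltn_subrL (leq_trans _ im).
split=> [|h]; first exact: F_anti.
by apply: nle; exact: F_strict.
Qed.

(** Write 1 = mu + w with mu in m and w in a supplement. Then m w lies in J, and
    w does not, so some s in the socle has w s nonzero. *)
Lemma maximal_ideal_annihilated (m : A^o -> Prop) : maximal_ideal m ->
  exists y : A, y <> 0 /\ forall a, m a -> a * y = 0.
Proof.
move=> mm; have [sm m1 _] := mm.
have [W [sW [mu [w [mmu Ww E]]] mW]] := ideal_supplement sm.
have [s [Ss ws]] : exists s, S s /\ w * s <> 0.
  apply: contrapT => no; apply: m1; rewrite E; apply: (submodD sm) => //.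
  suff /jacobsonP Jw : J w by exact: Jw.
  by apply: left_ann_socle => s Ss; apply: contrapT => ws; apply: no; exists s.
exists (w * s); split=> // a ma; rewrite mulrA.
have /killed1 Ss' : @killed _ A A^o 1 s := Ss.
apply: Ss'; apply: mW; last exact: (submodZ sW).
have -> : a * w = a - a * mu by rewrite -{2}[a]mulr1 E mulrDr addrC addKr.
by apply: (submodB sm) => //; exact: (submodZ sm).
Qed.

Lemma regular_cogenerator (M : lmodType A) (x : M) : x <> 0 ->
  exists f : {linear M -> A^o}, f x <> 0.
Proof.
move=> x0; have [|m [mm Im]] := maximal_ideal_exists (ker_submod (act x)).
  by rewrite /= scale1r.
have [y [y0 my]] := maximal_ideal_annihilated mm.
have [|f fE] := @extend_multiples _ A M A^o x y iA; last by exists f; rewrite fE.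
by move=> a ax; apply/my/Im.
Qed.

End QuasiFrobenius.

(** * Relative resolutions and coresolutions *)

Section Lifting.
Variable R : nzRingType.

Definition lifts (X L : lmodType R) (e : {linear X -> L}) (P : lmodType R) :=
  forall h : {linear P -> L}, exists h' : {linear P -> X}, forall x, e (h' x) = h x.

Definition extends (L X : lmodType R) (e : {linear L -> X}) (P : lmodType R) :=
  forall h : {linear L -> P}, exists h' : {linear X -> P}, forall x, h' (e x) = h x.

Lemma lifts_retract (X L : lmodType R) (e : {linear X -> L}) P Q :
  retract P Q -> lifts e Q -> lifts e P.
Proof.
move=> [s [r rs]] lQ h; have [h' hE] := lQ (h \o r).
by exists (h' \o s) => x /=; rewrite hE /= rs.
Qed.

Lemma lifts_zero (X L : lmodType R) (e : {linear X -> L}) P :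
  is_zero P -> lifts e P.
Proof. by move=> z h; exists \0 => x; rewrite (z x) !linear0. Qed.

Lemma lifts_prod (X L : lmodType R) (e : {linear X -> L}) (P Q : lmodType R) :
  lifts e P -> lifts e Q -> lifts e (P * Q)%type.
Proof.
move=> lP lQ h.
have [h1 h1E] := lP (h \o lpair idfun \0).
have [h2 h2E] := lQ (h \o lpair \0 idfun).
exists (lsum h1 h2) => -[x y]; rewrite /= /lsum_fun /= linearD h1E h2E /=.
by rewrite -linearD /lpair_fun /=; congr (h (_, _)); rewrite ?addr0 ?add0r.
Qed.

Lemma extends_retract (L X : lmodType R) (e : {linear L -> X}) P Q :
  retract P Q -> extends e Q -> extends e P.
Proof.
move=> [s [r rs]] lQ h; have [h' hE] := lQ (s \o h).
by exists (r \o h') => x /=; rewrite hE /= rs.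
Qed.

Lemma extends_zero (L X : lmodType R) (e : {linear L -> X}) P :
  is_zero P -> extends e P.
Proof. by move=> z h; exists \0 => x; rewrite (z (h x)). Qed.

Lemma extends_prod (L X : lmodType R) (e : {linear L -> X}) (P Q : lmodType R) :
  extends e P -> extends e Q -> extends e (P * Q)%type.
Proof.
move=> lP lQ h.
have [h1 h1E] := lP (fst \o h); have [h2 h2E] := lQ (snd \o h).
by exists (lpair h1 h2) => x; rewrite /= /lpair_fun h1E h2E /=; case: (h x).
Qed.

Definition ses (K X L : lmodType R) (i : {linear K -> X}) (e : {linear X -> L}) :=
  [/\ injective i, surj e & exact i e].

(** L has a resolution of length m by add(M) that stays exact under Hom(M, -),
    in the recursive form that is suited to inductions. *)
Fixpoint resolved (M : fgmod R) (m : nat) (L : fgmod R) : Prop :=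
  if m is m'.+1 then
    exists (X K : fgmod R) (i : {linear K -> X}) (e : {linear X -> L}),
      [/\ add_of M X, ses i e, lifts e M & resolved M m' K]
  else add_of M L.

Fixpoint coresolved (M : fgmod R) (m : nat) (L : fgmod R) : Prop :=
  if m is m'.+1 then
    exists (X C : fgmod R) (e : {linear L -> X}) (p : {linear X -> C}),
      [/\ add_of M X, ses e p, extends e M & coresolved M m' C]
  else add_of M L.

Definition seq_cons (L : fgmod R) (X : nat -> fgmod R) (j : nat) : fgmod R :=
  if j is j'.+1 then X j' else L.

Hypothesis nR : noetherian R.

Lemma lifts_add (X L : lmodType R) (e : {linear X -> L}) (M Y : fgmod R) :
  lifts e M -> add_of M Y -> lifts e Y.
Proof.
move=> lM /(add_ofP nR)[n]; move/lifts_retract; apply.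
apply: (mpow_ind (C := lifts e)) => // [|X' Y']; first exact/lifts_zero/mod0_zero.
exact: lifts_prod.
Qed.

Lemma extends_add (L X : lmodType R) (e : {linear L -> X}) (M Y : fgmod R) :
  extends e M -> add_of M Y -> extends e Y.
Proof.
move=> lM /(add_ofP nR)[n]; move/extends_retract; apply.
apply: (mpow_ind (C := extends e)) => // [|X' Y']; first exact/extends_zero/mod0_zero.
exact: extends_prod.
Qed.

Lemma resolved_add_resolution (M : fgmod R) m L : resolved M m L -> add_resolution m M L.
Proof.
elim: m L => [|m IH] L /=.
  move=> aL; exists (seq_cons L (fun=> mod0 R)).
  exists (fun=> \0), idfun; split.
  - split=> [[|j]//|[|j]//]; last by move=> _; exact: mod0_zero.
    exact/(add_zero nR)/mod0_zero.
  - by split=> [y|h]; [exists y|exists h].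
  - split=> [y|h] /=; first by split=> [->|[x <-]//]; exists 0.
    split=> [h0|[h' h'E] y]; last by rewrite -h'E.
    by exists \0 => y /=; rewrite h0.
  move=> j; split=> [y|h] /=.
    by split=> _; [exists 0; exact/esym/mod0_zero|case: j y].
  split=> [_|_ y]; last by case: j h.
  by exists \0 => y; exact/esym/mod0_zero.
move=> [X [K [i [e [aX [ii es ie] eM /IH[X' [d' [e' [[aX' zX'] [e's e'M]]
  [ex0 exH0] exS]]]]]]]].
exists (seq_cons X X').
exists (fun j => match j return {linear seq_cons X X' j.+1 ->
    seq_cons X X' j} with 0%N => i \o e' | j'.+1 => d' j' end).
exists e; split.
- split=> [[|j]|[|j]] //; [exact: aX'|by rewrite ltnS; exact: zX'].
- by split.
- split=> [y|h] /=.
    split=> [/ie[z <-]|[x <-]]; last by apply/ie; exists (e' x).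
    by have [x <-] := e's z; exists x.
  split=> [h0|[h' h'E] y]; last by rewrite -h'E; apply/ie; exists (e' (h' y)).
  have [|g gE] := lin_lift (f := h) ii; first by move=> y; exact/ie.
  by have [g' g'E] := e'M g; exists g' => y; rewrite g'E gE.
case=> [|j] /=; last exact: exS.
split=> [y|h] /=.
  split=> [/(inj_lin0 ii) /ex0 //|/ex0 ->]; exact: linear0.
split=> [h0|/exH0 h0 y]; last by rewrite h0 linear0.
by apply/exH0 => y; exact: inj_lin0 (h0 y).
Qed.

Lemma coresolved_add_coresolution (M : fgmod R) m L :
  coresolved M m L -> add_coresolution m M L.
Proof.
elim: m L => [|m IH] L /=.
  move=> aL; exists (seq_cons L (fun=> mod0 R)).
  exists (fun=> \0), idfun; split.
  - split=> [[|j]//|[|j]//]; last by move=> _; exact: mod0_zero.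
    exact/(add_zero nR)/mod0_zero.
  - by split=> [y|h]; [|exists h].
  - split=> [y|h] /=; first by split=> // _; exists y.
    split=> [h0|[h' h'E] y]; last by rewrite -h'E linear0.
    by exists \0 => y /=; rewrite h0.
  move=> j; split=> [y|h] /=.
    split=> [_|_]; last by case: j y.
    by exists 0; exact/esym/mod0_zero.
  split=> [_|_ x]; last by rewrite [X in h X]mod0_zero linear0.
  by exists \0 => y; rewrite [y]mod0_zero !linear0.
move=> [X [C [e [p [aX [ei ps ep] eM /IH[X' [d' [e' [[aX' zX'] [e'i e'M]]
  [ex0 exH0] exS]]]]]]]].
exists (seq_cons X X').
exists (fun j => match j return {linear seq_cons X X' j ->
    seq_cons X X' j.+1} with 0%N => e' \o p | j'.+1 => d' j' end).
exists e; split.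
- split=> [[|j]|[|j]] //; [exact: aX'|by rewrite ltnS; exact: zX'].
- by split.
- split=> [y|h] /=.
    split=> [/(inj_lin0 e'i) /ep //|[x <-]]; rewrite (_ : p (e x) = 0) ?linear0 //.
    by apply/ep; exists x.
  split=> [h0|[h' h'E] x]; last first.
    by rewrite -h'E (_ : p (e x) = 0) ?linear0 //; apply/ep; exists x.
  have [|g gE] := lin_factor (f := h) ps; first by move=> x /ep[z <-]; exact: h0.
  by have [g' g'E] := e'M g; exists g' => y; rewrite g'E gE.
case=> [|j] /=; last exact: exS.
split=> [y|h] /=.
  split=> [/ex0[c <-]|[x <-]]; last by apply/ex0; exists (p x).
  by have [x <-] := ps c; exists x.
split=> [h0|/exH0 h0 y]; last by rewrite h0.
by apply/exH0 => c; have [x <-] := ps c.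
Qed.

Lemma resolved_split (M E L' L : fgmod R) m (a : {linear E -> L}) (b : {linear L' -> L}) :
  bijective (lsum a b) -> add_of M E -> resolved M m L' -> resolved M m L.
Proof.
move=> ab aE; have [g [gK Kg]] := lin_inv ab; case: m => [|m] /=.
  move=> aL'; apply: (add_retract nR) (add_dsum nR aE aL').
  by exists g, (lsum a b).
move=> [X [K [i [e [aX [ii es ie] eM rK]]]]].
exists (dsum E X), K, (lpair \0 i : {linear K -> dsum E X}).
exists (lsum a (b \o e) : {linear dsum E X -> L}); split=> //.
- exact: add_dsum.
- split=> [x y [] /ii //|y|[y x]].
    by rewrite -[y]Kg; case: (g y) => u v; have [x <-] := es v; exists (u, x).
  rewrite /= /lsum_fun /= /lpair_fun /=; split=> [h|[z [<- <-]]].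
    have [-> ex] : y = 0 /\ e x = 0.
      have : lsum a b (y, e x) = lsum a b 0 by rewrite linear0 /= /lsum_fun /=.
      by move=> /(can_inj gK) [].
    by have /ie[z <-] := ex; exists z.
  have -> : e (i z) = 0 by apply/ie; exists z.
  by rewrite !linear0 addr0.
move=> h; have [h' h'E] := eM (snd \o g \o h).
exists (lpair (fst \o g \o h) h') => x.
rewrite /= /lsum_fun /= h'E /= -[RHS]Kg.
by case: (g (h x)).
Qed.

(** N is the m-th cokernel obtained from L by left approximations. Unlike
    [coresolved], the recursion runs over the last step, which is the one that
    the comparison below removes first. *)
Fixpoint approx (M : fgmod R) (m : nat) (L N : fgmod R) : Prop :=
  if m is m'.+1 then
    exists (N' X : fgmod R) (e : {linear N' -> X}) (p : {linear X -> N}),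
      [/\ approx M m' L N', add_of M X, ses e p & extends e M]
  else N = L.

Lemma approx_coresolved (M : fgmod R) m q L N :
  approx M m L N -> coresolved M q N -> coresolved M (m + q) L.
Proof.
elim: m q N => [|m IH] q N; first by move=> /= ->.
move=> [N' [X [e [p [aN' aX s eM]]]]] cN; rewrite addSnnS; apply: IH aN' _.
by exists X, N, e, p.
Qed.

(** Compare the last step N' -> X -> N of the approximations of L with the first
    step K' -> Y -> K of the resolution of K. The composite X -> K lifts to
    X -> Y, and its restriction N' -> K' factors through add(M) by induction,
    hence extends to X. Subtracting this extension leaves a map that vanishes on
    N' and so descends to a lift N -> Y of g. *)
Lemma approx_factor (M : fgmod R) m (L N K : fgmod R) (g : {linear N -> K}) :
  approx M m L N -> resolved M m K ->
  exists (Y : fgmod R) (s : {linear N -> Y}) (e : {linear Y -> K}),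
    add_of M Y /\ forall x, e (s x) = g x.
Proof.
elim: m N K g => [|m IH] N K g /=; first by move=> _ aK; exists K, g, idfun.
move=> [N' [X [e [p [aN' aX [ei ps ep] eM]]]]].
move=> [Y [K' [i [q [aY [ii qs iq] qM rK']]]]].
have [phi phiE] := lifts_add qM aX (g \o p).
have [x|psi psiE] := lin_lift (f := phi \o e) ii.
  apply/iq; rewrite /= phiE /= (_ : p (e x) = 0) ?linear0 //.
  by apply/ep; exists x.
have [Y1 [a [b [aY1 ab]]]] := IH _ _ psi aN' rK'.
have [a' a'E] := extends_add eM aY1 a.
have iq0 z : q (i z) = 0 by apply/iq; exists z.
have [x|s sE] := lin_factor (f := phi \+ (\- (i \o b \o a'))) ps.
  by move=> /ep[z <-] /=; rewrite a'E ab psiE subrr.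
exists Y, s, q; split=> // y; have [x <-] := ps y.
by rewrite sE /= linearB iq0 subr0 phiE.
Qed.

Lemma approx_add (M : fgmod R) m (L N : fgmod R) :
  approx M m L N -> resolved M m N -> add_of M N.
Proof.
move=> aN rN; have [Y [s [e [aY es]]]] := approx_factor idfun aN rN.
by apply: (add_retract nR) aY; exists s, e.
Qed.

Lemma coresolved_of_resolved (M : fgmod R) m :
  (forall L : fgmod R, exists (X : fgmod R) (e : {linear L -> X}),
    [/\ add_of M X, injective e & extends e M]) ->
  (forall L, resolved M m L) -> forall L, coresolved M m L.
Proof.
move=> ap rM L.
have [N aN] : exists N, approx M m L N.
  elim: m {rM} => [|m [N aN]]; first by exists L.
  have [X [e [aX ei eM]]] := ap N.
  have [C [p [ps pe]]] := quotient_fg (im_submod e).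
  by exists C, N, X, e, p.
rewrite -[m]addn0; apply: (approx_coresolved (q := 0%N) aN).
exact: approx_add aN (rM N).
Qed.

End Lifting.

(** * Approximations by the modules A/J^i *)

Section LeftApproximation.
Variables (k : fieldType) (A : falgType k).

Lemma klin_sum (X M : lmodType A) (I : finType) (c : I -> k)
    (f : I -> {linear X -> M}) :
  exists F : {linear X -> M}, forall x, F x = \sum_i (c i)%:A *: f i x.
Proof.
have FL : linear (fun x => \sum_i (c i)%:A *: f i x).
  move=> a x y; rewrite scaler_sumr -big_split; apply: eq_bigr => i _ /=.
  by rewrite linearP scalerDr !scalerA mulr_algl mulr_algr.
by exists (linear_of FL).
Qed.

Lemma mpow_into (M : fgmod A) (L : lmodType A) n (f : 'I_n -> {linear L -> M}) :
  exists F : {linear L -> mpow M n},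
    forall i, exists s : {linear mpow M n -> M}, forall x, s (F x) = f i x.
Proof.
elim: n f => [|n IH] f; first by exists \0 => -[].
have [F FP] := IH (fun i => f (lift ord0 i)).
exists (lpair (f ord0) F : {linear L -> mpow M n.+1}) => i.
case: (unliftP ord0 i) => [j ->|->]; last by exists fst.
have [s sE] := FP j.
by exists (s \o snd) => x /=; rewrite sE.
Qed.

Lemma lin_eq_gen (L M : lmodType A) n (g : 'I_n -> L) (f h : {linear L -> M}) :
  (forall x, exists c : 'I_n -> A, x = \sum_i c i *: g i) ->
  (forall i, f (g i) = h (g i)) -> forall x, f x = h x.
Proof.
move=> gP fh x; have [c ->] := gP x.
by rewrite !linear_sum; apply: eq_bigr => i _; rewrite !linearZ fh.
Qed.

(** Hom(L, M) is finite dimensional over k, and finitely many maps that span it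
    are the components of e. Maps from L are recorded by lifts of their values at
    generators, in a vector space whose dimension theory is available. *)
Lemma left_approximation (M L : fgmod A) :
  exists (X : fgmod A) (e : {linear L -> X}), add_of M X /\ extends e M.
Proof.
have [n [g gP]] := fg_fin L.
have [n' [pi [pis pi0 piD]]] := chart_exists M.
have [||V VP] := @vspace_exists _ {ffun 'I_n -> {ffun 'I_n' -> A}}
  (fun c => exists h : {linear L -> M}, forall j, h (g j) = pi (c j)).
- by exists \0 => j; rewrite ffunE pi0.
- move=> c x y [h hE] [h' h'E].
  have [F FE] := klin_sum (fun b : bool => if b then c else 1)
    (fun b : bool => if b then h else h').
  exists F => j; rewrite FE big_bool /= hE h'E !ffunE piD.
  by rewrite !scale1r.
have /choice[h hE] : forall i : 'I_(\dim V), exists h : {linear L -> M},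
    forall j, h (g j) = pi ((vbasis V)`_i j).
  by move=> i; apply/VP/vbasis_mem/mem_nth; rewrite size_tuple.
have [e eP] := mpow_into h.
exists (mpow M (\dim V)), e; split.
  by apply: add_mpow; [exact: noetherian_falg|exact/add_id/noetherian_falg].
move=> f; have /choice[c cE] : forall j, exists c, pi c = f (g j).
  by move=> j; exact: pis.
have Vc : [ffun j => c j] \in V by apply/VP; exists f => j; rewrite ffunE.
have /choice[s sE] := eP.
have [F FE] := klin_sum (fun i => coord (vbasis V) i [ffun j => c j]) s.
exists F; apply: (lin_eq_gen (f := F \o e) gP) => j /=; rewrite FE -cE.
have /(congr1 (fun u : {ffun _} => u j)) := coord_vbasis Vc.
rewrite ffunE => ->; rewrite sum_ffunE.
under [in LHS]eq_bigr => i _ do rewrite sE hE.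
under [in RHS]eq_bigr => i _ do rewrite ffunE.
elim/big_rec2: _ => [|i u v _ ->]; first exact/esym/pi0.
by rewrite piD.
Qed.

End LeftApproximation.

Section Auslander.
Variables (k : fieldType) (A : falgType k).
Local Notation J := (@jacobson k A).
Local Notation Jpow := (ideal_pow J).
Let nA : noetherian A := @noetherian_falg k A.

(** P is A/J^i with u the class of 1, specified by the functor it represents. *)
Definition represents (i : nat) (P : fgmod A) (u : P) :=
  [/\ forall y, exists a : A, y = a *: u, forall y : P, killed i y &
      forall (N : lmodType A) (x : N), killed i x ->
        exists f : {linear P -> N}, f u = x].

Lemma lifts_cyclic i (P : fgmod A) (u : P) (X L : lmodType A)
    (e : {linear X -> L}) : represents i u ->
  lifts e P <-> forall x, killed i x -> exists y, killed i y /\ e y = x.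
Proof.
move=> [gen ki univ]; split=> [le x /univ[f fu]|h f].
  have [f' f'E] := le f; exists (f' u).
  by split; [exact/killed_lin/ki|rewrite f'E].
have [y [ky ey]] := h _ (killed_lin f (ki u)).
have [f' f'u] := univ _ _ ky; exists f' => x; have [a ->] := gen x.
by rewrite !linearZ f'u ey.
Qed.

Lemma add_killed i (P X : fgmod A) :
  (forall y : P, killed i y) -> add_of P X -> forall x : X, killed i x.
Proof.
move=> kP /(add_ofP nA)[n [s [r rs]]] x; rewrite -[x]rs; apply: killed_lin.
move: (s x); elim: n {s r rs} => [|n IH] y.
  by rewrite (mod0_zero y); exact: (submod0 (killed_submod _ _)).
by case: y => y z; apply: killed_pair.
Qed.

Lemma cover_submod i (P L : fgmod A) (u : P) (U : L -> Prop) :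
  represents i u -> submod U -> (forall x, U x -> killed i x) ->
  exists r (f : {linear mpow P r -> L}), forall x, U x <-> exists y, f y = x.
Proof.
move=> [gen ki univ] sU Uk; have [r [g [gU gP]]] := noetherian_falg_fg sU.
have /choice[f fE] : forall j, exists f : {linear P -> L}, f u = g j.
  by move=> j; exact/univ/Uk.
have [F [F1 F2]] := mpow_onto f; exists r, F => x; split=> [/gP[c ->]|[y <-]].
  apply: (submod_sum (im_submod F)) => j; have [s sE] := F1 j.
  by exists (s (c j *: u)); rewrite sE linearZ fE.
have [c ->] := F2 y; apply: (submod_sum sU) => j; have [a ->] := gen (c j).
by rewrite linearZ fE; apply: (submodZ sU).
Qed.

(** A submodule of a free cover that is minimal among those mapping onto N
    is a direct summand: lifting the cover through it gives a surjective, hence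
    bijective, endomorphism. If an element v of the kernel were not in JV, here
    described as the intersection of all T such that J annihilates V/T, a
    complement of v in V/T would still map onto N. *)
Lemma projective_cover i (P N : fgmod A) (u : P) :
  represents i u -> (forall x : N, killed i x) ->
  exists (V : fgmod A) (f : {linear V -> N}), [/\ add_of P V, surj f &
    forall v, f v = 0 -> forall T : V -> Prop, submod T ->
      (forall a x, J a -> T (a *: x)) -> T v].
Proof.
move=> rep kN; have [gen ki univ] := rep.
have [r [F FP]] := cover_submod rep (U := fun _ : N => True)
  (conj I (fun _ _ _ _ _ => I)) (fun x _ => kN x).
have aQ : add_of P (mpow P r) by apply: (add_mpow nA); exact: (add_id nA).
have kQ := add_killed ki aQ.
have [|U [[sU UF] Umin]] := min_submod (Q := fun U : mpow P r -> Prop =>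
  submod U /\ forall y, exists x, U x /\ F x = y) (fun U => @proj1 _ _).
  by exists (fun=> True); split=> // y; have [x xE] := (FP y).1 I; exists x.
have [V [i' [ii iP]]] := nA sU.
have fs : surj (F \o i').
  by move=> y; have [x [/iP[z <-] <-]] := UF y; exists z.
have kV (z : V) : killed i z by apply: killed_inj ii _; exact: kQ.
have lV : lifts (F \o i') P.
  apply/(lifts_cyclic _ rep) => x _; have [z zx] := fs x.
  by exists z; split.
have [t tE] := lifts_add nA lV aQ F.
have ts : surj (t \o i').
  move=> z; suff [z' /ii] : exists z', i' (t (i' z')) = i' z by exists z'.
  apply: (Umin (fun x => exists z', i' (t (i' z')) = x)).
  - split; first exact: (im_submod (i' \o t \o i')).
    by move=> y; have [z' <-] := fs y; exists (i' (t (i' z'))); split;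
      [exists z'|exact: tE].
  - by move=> _ [z' <-]; apply/iP; eexists.
  by apply/iP; exists z.
have [g [gK Kg]] := lin_inv (inj_surj_bij (surj_inj ts) ts).
exists V, (F \o i'); split=> //.
  by apply: (add_retract nA) aQ; exists i', (g \o t) => x /=; exact: gK.
move=> v fv T sT JT.
have [Vb [p [ps pT]]] := quotient_fg sT.
have kVb (x : Vb) : killed 1 x.
  by have [y <-] := ps x; apply/killed1 => a Ja; rewrite -linearZ; apply/pT/JT.
have [|W [sW _ Wv WA]] := killed_complement (T := fun _ : Vb => True)
  (conj I (fun _ _ _ _ _ => I)) (fun x _ => kVb x) (multiples_submod (p v)).
  by [].
apply/pT; apply: Wv (multiples_id _).
suff [z [Wz /ii <-]] : exists z, W (p z) /\ i' z = i' v by [].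
apply: (Umin (fun x => exists z, W (p z) /\ i' z = x)).
- split.
    split=> [|a _ _ [z [Wz <-]] [z' [Wz' <-]]].
      by exists 0; rewrite !linear0; split=> //; exact: (submod0 sW).
    by exists (a *: z + z'); rewrite !linearP; split=> //; exact: sW.2.
  move=> y; have [z <-] := fs y.
  have [w [_ [Ww [a ->] E]]] := WA (p z) I.
  exists (i' (z - a *: v)); split.
    by exists (z - a *: v); split=> //; rewrite linearB linearZ E addrK.
  have fv' : F (i' v) = 0 := fv.
  by rewrite linearB linearZ linearB linearZ /= fv' scaler0 subr0.
- by move=> _ [z [_ <-]]; apply/iP; exists z.
by apply/iP; exists v.
Qed.

Variables (P : nat -> fgmod A) (u : forall i, P i).
Hypothesis rep : forall i, represents i (u i).

Lemma socle_cover (L : fgmod A) t : exists (X : fgmod A) (f : {linear X -> L}),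
  [/\ forall M, (forall i, (0 < i <= t)%N -> add_of M (P i)) -> add_of M X,
      forall x : X, killed t x &
      forall j, (0 < j <= t)%N -> lifts f (P j)].
Proof.
elim: t => [|t [X [f [aX kX lX]]]].
  exists (mod0 A), \0; split=> [M _|x|j].
  - exact/(add_zero nA)/mod0_zero.
  - by rewrite (mod0_zero x); exact: (submod0 (killed_submod _ _)).
  by rewrite lt0n leqn0 => /andP[/negbTE ->].
have [r [g gP]] := cover_submod (L := L) (rep t.+1) (killed_submod L t.+1)
  (fun x h => h).
have kQ : forall x : mpow (P t.+1) r, killed t.+1 x.
  have [_ kP _] := rep t.+1; apply: add_killed kP _.
  by apply: (add_mpow nA); exact: (add_id nA).
exists (dsum X (mpow (P t.+1) r)), (lsum f g : {linear dsum _ _ -> L}); split.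
- move=> M aM; apply: (add_dsum nA).
    by apply: aX => i /andP[i0 it]; apply: aM; rewrite i0 leqW.
  by apply: (add_mpow nA); apply: aM; rewrite ltnSn.
- by case=> x y; apply: killed_pair => //; exact: killed_le (leqnSn t) (kX x).
move=> j /andP[j0]; rewrite leq_eqVlt ltnS => /orP[/eqP ->|jt].
  apply/(lifts_cyclic _ (rep t.+1)) => x /gP[y <-]; exists (0, y).
  split; last by rewrite /= /lsum_fun /= linear0 add0r.
  by apply: killed_pair => //; exact: (submod0 (killed_submod _ _)).
have h : lifts f (P j) by apply: lX; rewrite j0.
move=> l; have [l' lE] := h l.
exists (lpair l' \0 : {linear P j -> dsum X (mpow (P t.+1) r)}) => x.
by rewrite /= /lsum_fun /= linear0 addr0.
Qed.

Variables (n : nat) (M : fgmod A).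
Hypothesis aM : forall i, (0 < i <= n)%N -> add_of M (P i).
Hypothesis liftM : forall (X L : fgmod A) (e : {linear X -> L}),
  (forall i, (0 < i <= n)%N -> lifts e (P i)) -> lifts e M.

(** In the approximation X + V -> L below, X is killed by J^(m+1) by choice,
    whereas V is only killed by J^(m+2). But an element of the kernel has its
    component in V in JV, because V covers the quotient of L by its elements
    killed by J^(m+1); so J^(m+1) kills the kernel. *)
Lemma resolved_killed m (L : fgmod A) : (m < n)%N ->
  (forall x : L, killed m.+1 x) -> resolved M m L.
Proof.
elim: m L => [|m IH] L mn kL.
  have [V [f [aV fs fk]]] := projective_cover (rep 1) kL.
  have kV : forall x : V, killed 1 x by have [_ k1 _] := rep 1; exact: add_killed aV.
  have fi : injective f.
    apply: lin_inj => v fv; apply: (fk v fv (fun x => x = 0)).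
      exact: (ker_submod (M := V) idfun).
    by move=> a x Ja; apply: (kV x); exact: Jpow1.
  have [g [gK Kg]] := lin_inv (inj_surj_bij fi fs).
  apply: (add_trans nA) (aM _) _; first by instantiate (1 := 1%N).
  by apply: (add_retract nA) aV; exists g, f.
have [X [f [aX kX lX]]] := socle_cover L m.+1.
have [N [p [ps pk]]] := quotient_fg (killed_submod L m.+1).
have kN (x : N) : killed m.+2 x by have [y <-] := ps x; apply: killed_lin.
have [V [fV [aV fVs fVk]]] := projective_cover (rep m.+2) kN.
have kV : forall x : V, killed m.+2 x by have [_ k1 _] := rep m.+2; exact: add_killed aV.
have lp : lifts p (P m.+2).
  apply/(lifts_cyclic _ (rep _)) => x _; have [y yx] := ps x.
  by exists y; split.
have [phi phiE] := lifts_add nA lp aV fV.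
pose e : {linear dsum X V -> L} := lsum f phi.
have eP x : exists y, killed m.+2 y /\ e y = x.
  have [v vE] := fVs (p x).
  have /pk kz : p (x - phi v) = 0 by rewrite linearB phiE vE subrr.
  have [y [ky yE]] := (lifts_cyclic f (rep m.+1)).1 (lX m.+1 (leqnn _)) _ kz.
  exists (y, v); split.
    by apply: killed_pair => //; exact: killed_le (leqnSn _) ky.
  by rewrite /= /lsum_fun /= yE subrK.
have [K [i [ii iP]]] := nA (ker_submod e).
exists (dsum X V), K, i, e; split.
- apply: (add_dsum nA); last by apply: (add_trans nA) (aM _) aV; rewrite mn.
  by apply: aX => j /andP[j0 jm]; apply: aM; rewrite j0 (leq_trans jm) // ltnW.
- by split=> // x; have [y [_ yE]] := eP x; exists y.
- apply: liftM => j /andP[j0 jn]; have [jm|jm] := leqP j m.+1.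
    have h : lifts f (P j) by apply: lX; rewrite j0.
    move=> l; have [l' lE] := h l.
    exists (lpair l' \0 : {linear P j -> dsum X V}) => x.
    by rewrite /= /lsum_fun /= linear0 addr0.
  apply/(lifts_cyclic _ (rep _)) => x _; have [y [ky yE]] := eP x.
  by exists y; split=> //; exact: killed_le jm ky.
apply: IH => [|z]; first exact: ltnW.
apply: killed_inj ii _; have /iP : exists z', i z' = i z by exists z.
case: (i z) => y v; rewrite /= /lsum_fun /= => E.
apply: killed_pair; first exact: kX.
apply: (fVk v); last 2 first.
- exact: killed_submod.
- move=> a x Ja b jb; rewrite scalerA; apply: kV; exact: Jpow_mulJ.
rewrite -phiE -[phi v]add0r -(subrr (f y)) [f y - _]addrC -addrA E addr0.
by rewrite linearN; apply/eqP; rewrite oppr_eq0; apply/eqP/pk/killed_lin/kX.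
Qed.

End Auslander.

(** * Loewy length and representation dimension *)

Section Least.
Variables P Q : nat -> Prop.

Lemma leastP : (exists n, P n /\ least P = (n%:Z)%:E) \/ least P = +oo%E.
Proof.
rewrite /least; case: pselect => [ex|_]; [left|by right].
by case: (ex_minnP ex) => n /asboolP Pn _; exists n.
Qed.

Lemma least_le n : P n -> (least P <= (n%:Z)%:E)%E.
Proof.
move=> Pn; rewrite /least; case: pselect => [ex|[]]; last first.
  by exists n; apply/asboolP.
by case: (ex_minnP ex) => m _; rewrite lee_fin; apply; apply/asboolP.
Qed.
End Least.

Lemma least_mono (P Q : nat -> Prop) :
  (forall n, P n -> Q n) -> (least Q <= least P)%E.
Proof.
move=> PQ; have [[n [Pn ->]]|->] := leastP P; last exact: leey.
exact/least_le/PQ.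
Qed.

Section RepresentationDimension.
Variables (k : fieldType) (A : falgType k).
Local Notation J := (@jacobson k A).
Local Notation Jpow := (ideal_pow J).
Let nA : noetherian A := @noetherian_falg k A.
Hypothesis iA : self_injective A.

Lemma sum_module (P : nat -> fgmod A) n : exists M : fgmod A,
  (forall i, (0 < i <= n)%N -> add_of M (P i)) /\
  forall (X L : fgmod A) (e : {linear X -> L}),
    (forall i, (0 < i <= n)%N -> lifts e (P i)) -> lifts e M.
Proof.
elim: n => [|n [M [aM lM]]].
  exists (mod0 A); split=> [i|X L e _]; last exact/lifts_zero/mod0_zero.
  by rewrite lt0n leqn0 => /andP[/negbTE ->].
exists (dsum (P n.+1) M); split=> [i /andP[i0]|X L e h].
  have rM : retract M (dsum (P n.+1) M).
    by exists (lpair \0 idfun : {linear M -> dsum (P n.+1) M}), snd.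
  have rP : retract (P n.+1) (dsum (P n.+1) M).
    by exists (lpair idfun \0 : {linear P n.+1 -> dsum (P n.+1) M}), fst.
  rewrite leq_eqVlt ltnS => /orP[/eqP ->|ilen].
    exact: (add_retract nA) rP (add_id nA _).
  apply: (add_trans nA) (aM i _); last by rewrite i0.
  exact: (add_retract nA) rM (add_id nA _).
apply: lifts_prod; first by apply: h; rewrite ltnSn.
by apply: lM => i /andP[i0 ilen]; apply: h; rewrite i0 leqW.
Qed.

(** Let C be a complement, in the socle of a free cover F of L, of the socle of
    the kernel. Its injective hull E in F meets the kernel trivially, so it
    embeds in L and splits off. As J^n F is contained in the socle of F, its
    image J^n L is contained in the image of E, so the complement of E is killed
    by J^n. *)
Lemma projective_injective_split n (L : fgmod A) :
  (forall x : A, Jpow n.+1 x -> x = 0) ->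
  exists (E L' : fgmod A) (a : {linear E -> L}) (b : {linear L' -> L}),
    [/\ bijective (lsum a b), add_of (regmod A) E & forall x : L', killed n x].
Proof.
move=> Jn; have [r [pi pis]] := free_cover L; set F := mpow _ r in pi pis.
have iF : injective_module F := mpow_injective (n := r) iA.
have sS := killed_submod F 1.
have sU := meet_submod (ker_submod pi) sS.
have [|C [sC CS CU SC]] := killed_complement sS (fun x h => h) sU.
  by move=> x [].
have [E [t [sE CE Et tE Ees]]] := injective_hull iF sC.
have [KE [i [ii iP]]] := nA sE.
have [|s sP] := lin_lift (f := t) ii; first by move=> x; exact/iP.
have si z : s (i z) = z by apply: ii; rewrite sP tE //; apply/iP; exists z.
have rKE : retract KE F by exists i, s.
have pii : injective (pi \o i).
  apply: lin_inj => z /= pz; apply: contrapT => z0.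
  have Ez : E (i z) by apply/iP; exists z.
  have [|c [Cc c0]] := Ees _ Ez; first by move=> /(inj_lin0 ii).
  apply: c0; apply: CU => //; split; last exact: CS.
  by rewrite linearZ /= pz scaler0.
have iKE : injective_module KE := retract_injective rKE iF.
have [rho rhoE] := iKE _ _ (pi \o i) idfun pii.
have [L' [b [bi bP]]] := nA (ker_submod rho).
exists KE, L', (pi \o i), b; split.
- apply: inj_surj_bij => [|x].
    apply: lin_inj => -[z l]; rewrite /= /lsum_fun /= => E0.
    have rb : rho (b l) = 0 by apply/bP; exists l.
    have := congr1 rho E0; rewrite linearD rb addr0 rhoE linear0 /= => z0.
    by move: E0; rewrite z0 !linear0 add0r => /(inj_lin0 bi) ->.
  have /bP[l lE] : rho (x - pi (i (rho x))) = 0.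
    by rewrite linearB rhoE subrr.
  by exists (rho x, l); rewrite /= /lsum_fun /= lE addrC subrK.
- apply: (add_retract nA) rKE _; exact/(add_mpow nA)/(add_id nA).
(* For a in J^n, the element a (b l) lies both in the image of E and in the
   kernel of rho. *)
move=> l; apply: (killed_inj bi) => a ja.
have [f fE] := pis (b l).
have kf : killed n.+1 f by move=> c jc; rewrite (Jn c) // scale0r.
have [c [w [Cc [pw _] afE]]] := SC _ (killedS_l kf ja).
have [z zc] := (iP c).1 (CE _ Cc).
have E0 : a *: b l = pi (i z) by rewrite -fE -linearZ afE linearD pw addr0 zc.
have : rho (a *: b l) = z by rewrite E0 rhoE.
have -> : rho (a *: b l) = 0.
  by rewrite linearZ /= (_ : rho (b l) = 0) ?scaler0 //; apply/bP; exists l.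
by rewrite E0 => <-; rewrite !linear0.
Qed.

Lemma auslander_bound n : (forall x : A, Jpow n.+2 x -> x = 0) ->
  exists M : fgmod A, forall L : fgmod A,
    add_resolution n M L /\ add_coresolution n M L.
Proof.
move=> Jn.
have /choice[P /(_ _)/cid Pu] : forall i, exists P u, @represents k A i P u.
  by move=> i; exact: jquot_exists.
pose u i := sval (Pu i).
have rep i : represents i (u i) := svalP (Pu i).
have [M [aM lM]] := sum_module P n.+2.
have aR : add_of M (regmod A).
  apply: (add_retract nA) (aM n.+2 _); last by rewrite leqnn.
  have [_ _ univ] := rep n.+2.
  have [|f fE] := univ A^o 1; first by move=> a /Jn ->; rewrite scale0r.
  exists (act (u n.+2)), f => x.
  by rewrite /= linearZ fE; exact: mulr1.
have resL L : resolved M n L.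
  have [E [L' [a [b [ab aE kL']]]]] := projective_injective_split L Jn.
  apply: (resolved_split nA ab); first exact: (add_trans nA) aR aE.
  by apply: resolved_killed kL' => //.
exists M => L; split; first exact/(resolved_add_resolution nA)/resL.
apply/(coresolved_add_coresolution nA)/(coresolved_of_resolved nA) => // L0.
have [X [e [aX eM]]] := left_approximation M L0.
exists X, e; split=> //; apply: lin_inj => x ex; apply: contrapT => x0.
have [f fx] := regular_cogenerator iA Jn x0.
have [g gE] := extends_add nA eM aR f.
by apply: fx; rewrite -gE ex linear0.
Qed.

Lemma repdim_le_loewy : ~ semisimple A -> (repdim A <= loewy_length A)%E.
Proof.
move=> nss; apply: least_mono => -[|[|n]] Jn.
- by have /eqP := Jn 1 I; rewrite oner_eq0.
- by case: nss; apply: jacobson0_semisimple => x /Jpow1; exact: Jn.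
by split=> //; rewrite !subSS subn0; exact: auslander_bound.
Qed.

End RepresentationDimension.

(** * Representation dimension and weak representation dimension *)

Section ResolutionComplex.
Variable R : nzRingType.
Variables (X : nat -> fgmod R) (d : forall j, {linear X j.+1 -> X j}) (n : nat).
Hypothesis Xn : forall j, (n < j)%N -> is_zero (X j).
Hypothesis dd : forall j x, d j (d j.+1 x) = 0.

Definition res_ob (i : int) : fgmod R :=
  match i with Posz 0 => X 0 | Posz _.+1 => mod0 R | Negz j => X j.+1 end.

(** The cases are those needed for i + 1 to compute to the right degree. *)
Definition res_diff (i : int) : {linear res_ob i -> res_ob (i + 1)} :=
  match i return {linear res_ob i -> res_ob (i + 1)} with
  | Posz 0 => \0 | Posz _.+1 => \0
  | Negz 0 => d 0 | Negz 1 => d 1 | Negz j.+2 => d j.+2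
  end.

Lemma res_diffK i x : res_diff (i + 1) (res_diff i x) = 0.
Proof.
case: i x => [[|j]|[|[|[|j]]]] x; try exact: mod0_zero; exact: dd.
Qed.

Lemma res_bounded : exists m : int, forall i, m < `|i| -> is_zero (res_ob i).
Proof.
exists n%:Z => -[[|j]|j] h /=; [by []|exact: mod0_zero|].
by apply: Xn; rewrite -ltz_nat.
Qed.

Definition res_complex := BComplex res_diffK res_bounded.

End ResolutionComplex.

Lemma wrepdim_le_repdim (R : nzRingType) : (wrepdim R <= repdim R)%E.
Proof.
apply: least_mono => i [i2 [M MP]]; split=> //; exists M => L.
have [[X [d [e [[aX zX] [es _] [ex0 _] exS]]]] _] := MP L.
have dd j x : d j (d j.+1 x) = 0 by apply/(exS j).1; exists x.
exists (res_complex zX dd); split.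
- move=> [[|j]|j] /=; [exact: aX| |exact: aX].
  exists 0%N, (mod0 R).
  exists (fst : {linear dsum (mod0 R) (mod0 R) -> mod0 R}).
  apply: inj_surj_bij => [[x y] [x' y'] _|y]; last by exists (y, 0).
  by rewrite [x]mod0_zero [x']mod0_zero [y]mod0_zero [y']mod0_zero.
- exists L.
    exists (X 0%N), idfun, e; split.
    + by move=> x y.
    + by move=> y; split=> // _; exists y.
    + exact: es.
    + exact: ex0.
  exists (mod0 R), (fst : {linear dsum L (mod0 R) -> L}).
  apply: inj_surj_bij => [[x y] [x' y'] /= ->|y]; last by exists (y, 0).
  by rewrite [y]mod0_zero [y']mod0_zero.
- move=> [[|j]|[|[|[|j]]]] // _ y /=.
  + by split=> // _; exists 0; exact/esym/mod0_zero.
  + by split=> // _; exists 0; exact/esym/mod0_zero.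
  + exact: (exS 0%N).1.
  + exact: (exS 1%N).1.
  + exact: (exS j.+2).1.
exists (- (i - 2)%N%:Z), 0; split.
- by rewrite oppr_le0.
- by rewrite sub0r opprK -subzn.
move=> [[|j]|j] //=; first by rewrite orbC /= ltNge oppr_le0 /=.
  by move=> _; exact: mod0_zero.
rewrite orbF NegzE ltrN2 ltz_nat; exact: zX.
Qed.

(** * Perfect complexes and triangles *)

Lemma addrA_cancel (V : zmodType) (a b y : V) : a - b + (b + y - a) = y.
Proof. by rewrite -addrA [- b + _]addrA [- b + _]addrA addNr add0r addrC subrK. Qed.

Section Perfect.
Variable R : nzRingType.
Implicit Types X Y : bcomplex R.

Definition acyclic X := forall i x, cdiff X (i + 1) x = 0 ->
  exists y, cdiff X i y = x.

Lemma quasi_iso_acyclic X Y (f : cmap X Y) : acyclic X -> acyclic Y -> quasi_iso f.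
Proof.
move=> aX aY i; split=> [x /aX //|y /aY[y' <-]].
by exists 0; [exact: linear0|exists (- y'); rewrite !linear0 linearN sub0r].
Qed.

(** Given (x, y) with dx = 0 and fx + dy = 0, the first half of f being a
    quasi-isomorphism provides x' with dx' = x, and the second half corrects
    f x' + y by a cycle of X to a boundary. *)
Lemma cone_acyclic X Y (f : cmap X Y) : quasi_iso f -> acyclic (cone f).
Proof.
move=> qf i [x y] [/= /eqP]; rewrite oppr_eq0 => /eqP dx.
move=> /addr0_eq dy.
have [|x' x'E] := (qf (i + 1)).1 x dx.
  by exists (- y); rewrite linearN -dy opprK.
have dz : cdiff Y (i + 1) (f (i + 1) x' + y) = 0.
  by rewrite linearD -cmapC x'E -dy subrr.
have [x'' dx'' [y' y'E]] := (qf i).2 _ dz.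
exists (x'' - x', - y'); apply/pair_equal_spec; split=> /=.
  by rewrite linearB dx'' sub0r opprK.
by rewrite linearB linearN y'E opprB addrA_cancel.
Qed.

Definition cmap_id X : cmap X X :=
  @CMap R X X (fun i => idfun) (fun i x => erefl).

Lemma quasi_iso_id X : quasi_iso (cmap_id X).
Proof.
move=> i; split=> [x _ [y yx]|y dy]; first by exists y.
by exists y => //; exists 0; rewrite /= linear0 subrr.
Qed.

Definition cmap0 X Y : cmap X Y :=
  @CMap R X Y (fun i => \0) (fun i x => esym (linear0 (cdiff Y i))).

(** The cone of an identity map of a perfect complex is acyclic, and any map
    between acyclic complexes is a quasi-isomorphism. *)
Lemma perfect_acyclic X : acyclic X -> perfect X.
Proof.
move=> aX; pose S := stalk (regmod R).
have pc : perfect (cone (cmap_id S)) by apply: perfect_cone; exact: perfect_regular.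
apply: (perfect_qi (f := cmap0 _ X)) pc.
by apply: quasi_iso_acyclic => //; exact/cone_acyclic/quasi_iso_id.
Qed.

Lemma perfect_cone_qi X Y (f : cmap X Y) : quasi_iso f -> perfect (cone f).
Proof. by move=> /cone_acyclic /perfect_acyclic. Qed.

Lemma quotient_iso_qi X Y (f : cmap X Y) : quasi_iso f -> quotient_iso X Y.
Proof.
move=> qf; exists X, (cmap_id X), f.
by split; apply: perfect_cone_qi => //; exact: quasi_iso_id.
Qed.

Lemma quotient_iso_refl X : quotient_iso X X.
Proof. exact: quotient_iso_qi (quasi_iso_id X). Qed.

Section ConeTriangle.
Variables (X Y : bcomplex R) (f : cmap X Y).

Lemma cone_projC i x :
  (fst : {linear cone f (i + 1) -> shift X (i + 1)}) (cdiff (cone f) i x) =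
  cdiff (shift X) i ((fst : {linear cone f i -> shift X i}) x).
Proof. by []. Qed.

Definition cone_proj : cmap (cone f) (shift X) :=
  @CMap R (cone f) (shift X) (fun i => (fst : {linear cone f i -> shift X i}))
    cone_projC.

(** The comparison of Y[1] with the cone of cone(f) -> X[1], that is, the
    rotation axiom. *)
Definition rotate_fun i : {linear shift Y i -> cone cone_proj i} :=
  lpair (lpair \0 idfun) \0.

Lemma rotateC i x : rotate_fun (i + 1) (cdiff (shift Y) i x) =
  cdiff (cone cone_proj) i (rotate_fun i x).
Proof.
rewrite /rotate_fun /=; apply/pair_equal_spec; split=> /=.
  by apply/pair_equal_spec; split; rewrite /= !linear0 ?oppr0 ?add0r.
by rewrite !linear0 ?oppr0 ?addr0.
Qed.

Definition rotate : cmap (shift Y) (cone cone_proj) :=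
  @CMap R (shift Y) (cone cone_proj) rotate_fun rotateC.

Lemma quasi_iso_rotate : quasi_iso rotate.
Proof.
move=> i; split=> [y /= dy [[[a b] c] /= E]|[[a b] c] /= E].
  move: E => /pair_equal_spec[/pair_equal_spec[/= Ea Eb] /= Ec].
  exists (f (i + 1) c + b); rewrite /= linearD -cmapC -Eb.
  by move/eqP: Ec; rewrite subr_eq0 => /eqP ->.
move: E => /pair_equal_spec[/pair_equal_spec[/= Ea Eb] /= Ec].
have ac : a = cdiff X (i + 1 + 1) c by apply/eqP; rewrite -subr_eq0; apply/eqP.
exists (f (i + 1 + 1) c + b).
  by rewrite /= linearD -cmapC -ac; exact: Eb.
exists ((- c, 0), 0); apply/pair_equal_spec; split=> /=.
  apply/pair_equal_spec; split=> /=; first by rewrite opprK linearN ac sub0r.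
  by rewrite linearN linear0 addr0 opprK addrK.
by rewrite linear0 oppr0 addr0 sub0r.
Qed.

Lemma perfect_cone_proj : perfect Y -> perfect (cone cone_proj).
Proof. by move=> pY; apply: (perfect_qi quasi_iso_rotate); exact: perfect_shift. Qed.

Lemma perfect_mid : perfect X -> perfect (cone f) -> perfect Y.
Proof.
move=> pX pC; apply: perfect_unshift; apply: (perfect_qi' quasi_iso_rotate).
by apply: perfect_cone => //; exact: perfect_shift.
Qed.
End ConeTriangle.

Section StalkMaps.
Variables (M N : fgmod R) (f : {linear M -> N}).

(** Stalk complexes branch on whether the degree is 0; abstracting that boolean
    lets exactness be checked without case analysis on degrees. *)
Definition bool_map (b : bool) : {linear (if b then M else mod0 R) ->
    (if b then N else mod0 R)} :=
  match b return {linear (if b then M else mod0 R) -> (if b then N else mod0 R)}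
  with true => f | false => \0 end.

Definition stalk_fun (i : int) : {linear stalk_ob M i -> stalk_ob N i} :=
  bool_map (i == 0).

Definition stalk_map : cmap (stalk M) (stalk N) :=
  @CMap R (stalk M) (stalk N) stalk_fun (fun i x => linear0 (stalk_fun (i + 1))).
End StalkMaps.

Section ShortExact.
Variables (K X L : fgmod R) (i : {linear K -> X}) (e : {linear X -> L}).
Hypothesis iex : ses i e.

Lemma bool_map_ses b : ses (bool_map i b) (bool_map e b).
Proof.
case: b => //=; split=> [x y _|y|y].
- by rewrite [x]mod0_zero [y]mod0_zero.
- by exists 0; exact/esym/mod0_zero.
by split=> // _; exists 0; exact/esym/mod0_zero.
Qed.

Definition cone_stalk_fun j : {linear cone (stalk_map i) j -> stalk L j} :=
  stalk_fun e j \o snd.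

Lemma cone_stalkC j x : cone_stalk_fun (j + 1) (cdiff (cone (stalk_map i)) j x) =
  cdiff (stalk L) j (cone_stalk_fun j x).
Proof.
rewrite /cone_stalk_fun /= addr0; have [_ _ ex] := bool_map_ses (j + 1 == 0).
by apply/ex; exists x.1.
Qed.

Definition cone_stalk : cmap (cone (stalk_map i)) (stalk L) :=
  @CMap R (cone (stalk_map i)) (stalk L) cone_stalk_fun cone_stalkC.

Lemma quasi_iso_cone_stalk : quasi_iso cone_stalk.
Proof.
move=> j; split=> [[a b] /= /pair_equal_spec[_ /= ab] [y /= eb]|y _].
  have [_ _ ex] := bool_map_ses (j + 1 == 0).
  have [z zb] := (ex b).1 (esym eb).
  have [ii _ _] := bool_map_ses (j + 1 + 1 == 0).
  have a0 : a = 0 by apply: (inj_lin0 ii); rewrite -[LHS]addr0.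
  exists (z, 0); apply/pair_equal_spec; split=> /=; first by rewrite a0 oppr0.
  by rewrite addr0.
have [_ es _] := bool_map_ses (j + 1 == 0); have [x xy] := es y.
exists (0, x); last by exists 0; rewrite /= -xy subrr.
by apply/pair_equal_spec; split=> /=; rewrite ?oppr0 // linear0 addr0.
Qed.

Lemma stable_triangle_ses : stable_triangle K X L.
Proof.
exists (stalk K), (stalk X), (stalk_map i); split; try exact: quotient_iso_refl.
exact: quotient_iso_qi quasi_iso_cone_stalk.
Qed.

Lemma perfect_extension : perfect (stalk K) -> perfect (stalk L) ->
  perfect (stalk X).
Proof.
move=> pK pL; apply: (perfect_mid (f := stalk_map i)) => //.
exact: perfect_qi' quasi_iso_cone_stalk pL.
Qed.

Lemma stable_shift_ses : perfect (stalk X) -> stable_shift K L.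
Proof.
move=> pX; exists (cone (stalk_map i)), cone_stalk, (cone_proj (stalk_map i)).
split; first exact/perfect_cone_qi/quasi_iso_cone_stalk.
exact: perfect_cone_proj.
Qed.
End ShortExact.

Lemma perfect_free n : perfect (stalk (mpow (regmod R) n)).
Proof.
elim: n => [|n IH].
  apply: perfect_acyclic => i x _; exists 0; rewrite /=.
  by move: x; rewrite /= /stalk_ob; case: ifP => _ x; exact/esym/mod0_zero.
apply: (perfect_extension
  (i := lpair idfun \0 : {linear regmod R -> mpow (regmod R) n.+1})
  (e := snd : {linear mpow (regmod R) n.+1 -> mpow (regmod R) n})) IH => //.
  split=> [x y [] //|y|[x y]]; first by exists (0, y).
  by split=> [/= ->|[z [_ <-]] //]; exists x.
exact: perfect_regular.
Qed.

End Perfect.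

(** * Weak representation dimension and the stable category *)

Section Generation.
Variable R : nzRingType.
Hypothesis nR : noetherian R.

Lemma stable_iso_iso (X Y : fgmod R) : module_iso X Y -> stable_iso X Y.
Proof.
move=> [f /lin_inv[g [fK gK]]]; exists f, g.
have pr0 := zero_projective (@mod0_zero R).
by split; exists (mod0 R), \0, \0; split=> // x; rewrite /= ?fK ?gK subrr.
Qed.

Lemma stable_zero (P : fgmod R) : projective P -> stable_iso P (mod0 R).
Proof.
move=> pP; exists \0, \0; split.
  by exists P, idfun, (\- idfun); split=> // x; rewrite /= sub0r.
by exists P, \0, \0; split=> // x; rewrite /= [x]mod0_zero subr0.
Qed.

Section Closure.
Variable I : fgmod R -> Prop.

Lemma gen_retract (X Y : fgmod R) : retract X Y -> generated I Y -> generated I X.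
Proof.
move=> /(direct_summandP nR)[Z iso]; apply: gen_summand.
by exists Z; exact: stable_iso_iso.
Qed.

Lemma gen_is_zero (Z : fgmod R) : is_zero Z -> generated I Z.
Proof.
move=> z; apply: gen_retract (gen_zero I).
by exists \0, \0 => x; rewrite /= [RHS]z.
Qed.

Lemma gen_projective (P : fgmod R) : projective P -> generated I P.
Proof.
move=> pP; apply: gen_summand (gen_zero I); exists (mod0 R).
apply: stable_zero; apply: projective_prod => //.
exact/zero_projective/mod0_zero.
Qed.

Lemma gen_mpow (M : fgmod R) n : generated I M -> generated I (mpow M n).
Proof. by move=> gM; elim: n => [|n IH]; [exact: gen_zero|exact: gen_sum]. Qed.

Lemma gen_add (M X : fgmod R) : generated I M -> add_of M X -> generated I X.
Proof. by move=> gM /(add_ofP nR)[n /gen_retract]; apply; exact: gen_mpow. Qed.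
End Closure.

(** Projectives vanish in the stable category, so the kernel W of a map from a
    projective module onto H is H[-1]. *)
Lemma syzygy (H : fgmod R) : exists (P W : fgmod R) (i : {linear W -> P})
    (e : {linear P -> H}), [/\ projective P, ses i e & stable_shift W H].
Proof.
have [n [e es]] := free_cover H.
have [W [i [ii iP]]] := nR (ker_submod e).
have sie : ses i e by [].
exists (mpow (regmod R) n), W, i, e; split=> //; first exact: mpow_projective.
exact: stable_shift_ses sie (perfect_free _ n).
Qed.

Variable M : fgmod R.
Local Notation gen := (generated (eq M)).

(** Exact sequences 0 -> Z -> X_1 -> ... -> X_q -> 0, the terms of which are
    generated by M in one step. *)
Fixpoint right_chain (q : nat) (Z : fgmod R) : Prop :=
  if q is q'.+1 then
    exists (X Z' : fgmod R) (i : {linear Z -> X}) (e : {linear X -> Z'}),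
      [/\ gen X, ses i e & right_chain q' Z']
  else is_zero Z.

(** Exact sequences 0 -> X_p -> ... -> X_1 -> B -> 0, the terms of which are
    generated by M in one step. *)
Fixpoint left_chain (p : nat) (B : fgmod R) : Prop :=
  if p is p'.+1 then
    exists (X B' : fgmod R) (i : {linear B' -> X}) (e : {linear X -> B}),
      [/\ gen X, ses i e & left_chain p' B']
  else is_zero B.

(** Rotating the triangle of 0 -> Z -> X -> Z' -> 0 puts a syzygy W of Z' on the
    left. Concretely, the pullback Y of a projective P mapping onto Z' along
    X -> Z' fits in 0 -> W -> Y -> X -> 0, and it is Z + P. *)
Lemma right_chain_generated q Z : right_chain q Z -> generated_in (eq M) q Z.
Proof.
elim: q Z => [|q IH] Z /=.
  by move=> z; apply: stable_zero; exact: zero_projective.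
move=> [X [Z' [i [e [gX [ii es ie]]]]]]; case: q IH => [|q] IH rZ'.
  apply: gen_in; exists (mod0 R), Z; split.
  - exact/stable_zero/zero_projective/mod0_zero.
  - apply: gen_retract gX; have [x|g gE] := lin_lift (f := idfun) ii.
      by apply/ie; exact: rZ'.
    by exists i, g => z; apply: ii; rewrite gE.
  apply: (stable_triangle_ses (i := \0) (e := idfun)); split=> [x y _|y|y].
  - by rewrite [x]mod0_zero [y]mod0_zero.
  - by exists y.
  by split=> [/= ->|[x <-]] //; exists 0.
have gZ' := IH _ rZ'.
have [P [W [w [F [pP [wi Fs wF] sh]]]]] := syzygy Z'.
have [Y [j [ji jP]]] := nR (ker_submod (M := dsum X P) (lsum e (\- F))).
have [phi phiE] := pP _ _ e F es.
have jE y : e (j y).1 = F (j y).2.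
  have /jP /eqP : exists z, j z = j y by exists y.
  by rewrite subr_eq0 => /eqP.
have [z|s sE] := lin_lift (f := lpair i \0) ji.
  apply/jP; rewrite /= /lsum_fun /= linear0 oppr0 addr0.
  by apply/ie; exists z.
have [y|r rE] := lin_lift (f := fst \o j \+ (\- (phi \o snd \o j))) ii.
  by apply/ie; rewrite /= linearB phiE jE subrr.
apply: (gen_retract (Y := Y)).
  exists s, r => z; apply: ii.
  by rewrite rE /= sE /= linear0 subr0.
apply: gen_in; exists W, X; split=> //; first exact: gen_unshift sh gZ'.
have [v|g gE] := lin_lift (f := lpair \0 w) ji.
  apply/jP; rewrite /= /lsum_fun /= linear0 add0r.
  by rewrite (_ : F (w v) = 0) ?oppr0 //; apply/wF; exists v.
apply: (stable_triangle_ses (i := g) (e := fst \o j)); split.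
- by move=> v v' /(congr1 j); rewrite !gE => -[] /wi.
- move=> x; have [p pE] := Fs (e x).
  have /jP[y yE] : lsum e (\- F) (x, p) = 0 by rewrite /= /lsum_fun /= pE subrr.
  by exists y; rewrite /= yE.
move=> y; split=> [/= y0|[v <-]]; last by rewrite /= gE.
have /wF[v vE] : F (j y).2 = 0 by rewrite -jE y0 linear0.
exists v; apply: ji; rewrite gE /= /lpair_fun /= vE -y0.
by case: (j y).
Qed.

(** The two chains together are a complex with H as its only homology, at Z. Let
    P be a projective module mapping onto H, and X the term next to Z. Replacing
    X by X + P makes the complex exact at Z, with the kernel Z1 of X + P -> Z
    starting a longer right chain, and moves the homology one step to the left,
    where it is the syzygy of H. *)
Lemma chain_generated p q (B Z H : fgmod R) (i : {linear B -> Z})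
    (e : {linear Z -> H}) : ses i e -> left_chain p B -> right_chain q.+1 Z ->
  generated_in (eq M) (p + q.+1) H.
Proof.
elim: p q B Z H i e => [|p IH] q B Z H i e [ii es ie].
  move=> z0 /right_chain_generated gZ; apply: (gen_retract (Y := Z)) gZ.
  have ei : injective e.
    by apply: lin_inj => z /ie[b <-]; rewrite (z0 b) linear0.
  have [g [gK Kg]] := lin_inv (inj_surj_bij ei es).
  by exists g, e.
move=> [X [B' [iB [eB [gX [iBi eBs ieB] lB']]]]] rZ.
have [P [W [w [F [pP [wi Fs wF] sh]]]]] := syzygy H.
have [phi phiE] := pP _ _ e F es.
have [Z1 [j [ji jP]]] := nR (ker_submod (M := dsum X P) (lsum (i \o eB) phi)).
have jE y : i (eB (j y).1) + phi (j y).2 = 0.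
  have /jP // : exists z, j z = j y by exists y.
have ei0 b : e (i b) = 0 by apply/ie; exists b.
have rZ1 : right_chain q.+2 Z1.
  exists (dsum X P), Z, j, (lsum (i \o eB) phi); split=> //.
    by apply: gen_sum => //; exact: gen_projective.
  split=> // z; have [pz pzE] := Fs (e z).
  have /ie[b bE] : e (z - phi pz) = 0 by rewrite linearB phiE pzE subrr.
  have [x xb] := eBs b.
  by exists (x, pz); rewrite /= /lsum_fun /= xb bE subrK.
have [b|g gE] := lin_lift (f := lpair iB \0) ji.
  apply/jP; rewrite /= /lsum_fun /= linear0 addr0.
  by rewrite (_ : eB (iB b) = 0) ?linear0 //; apply/ieB; exists b.
have [y|f fE] := lin_lift (f := snd \o j) wi.
  apply/wF; rewrite /= -phiE; have := congr1 e (jE y).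
  by rewrite linearD ei0 add0r linear0.
have gW : generated_in (eq M) (p + q.+2) W.
  apply: (IH q.+1 _ _ _ g f) lB' rZ1; split.
  - by move=> v v' /(congr1 j); rewrite !gE => -[] /iBi.
  - move=> v; have /ie[b bE] : e (phi (w v)) = 0.
      by rewrite phiE; apply/wF; exists v.
    have [x xb] := eBs b.
    have /jP[y yE] : lsum (i \o eB) phi (- x, w v) = 0.
      by rewrite /= /lsum_fun /= !linearN xb bE addNr.
    by exists y; apply: wi; rewrite fE /= yE.
  move=> y; split=> [fy|[b <-]]; last by apply: wi; rewrite fE /= gE linear0.
  have y2 : (j y).2 = 0 by rewrite -[LHS]/((snd \o j) y) -fE fy linear0.
  have /ieB[b bE] : eB (j y).1 = 0.
    by apply: (inj_lin0 ii); have := jE y; rewrite y2 linear0 addr0.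
  exists b; apply: ji; rewrite gE /= /lpair_fun /= bE -y2.
  by case: (j y).
rewrite addSnnS addnS; apply: gen_shift sh _.
by move: gW; rewrite addnS.
Qed.

Section Complex.
Variable C : bcomplex R.
Hypothesis gC : forall j, gen (C j).
Hypothesis exC : forall j, j != -1 -> exact (cdiff C j) (cdiff C (j + 1)).

Lemma right_chain_cycles t (j : int) (K : fgmod R) (inc : {linear K -> C (j + 1)}) :
  -1 <= j -> (forall i, j + 1 + t%:Z <= i -> is_zero (C i)) -> injective inc ->
  (forall y, cdiff C (j + 1) y = 0 <-> exists z, inc z = y) -> right_chain t K.
Proof.
elim: t j K inc => [|t IH] j K inc jle z0 ii iP /=.
  by move=> x; apply: (inj_lin0 ii); apply: z0; rewrite addr0.
have [K' [i' [ii' iP']]] := nR (ker_submod (cdiff C (j + 1 + 1))).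
have j1 : j + 1 != -1 by rewrite gt_eqF // (le_lt_trans jle) // ltrDl.
have ex := exC j1.
have [x|g gE] := lin_lift (f := cdiff C (j + 1)) ii'.
  by apply/iP'; exact: cdiffK.
exists (C (j + 1)), K', inc, g; split=> //.
  split=> // [y|y].
    have /iP' /ex[x xE] : exists z, i' z = i' y by exists y.
    by exists x; apply: ii'; rewrite gE.
  split=> [gy|/iP h]; first by apply/iP; rewrite -gE gy linear0.
  by apply: ii'; rewrite gE h linear0.
apply: (IH _ _ i') => //; first by rewrite (le_trans jle) // lerDl.
by move=> i h; apply: z0; rewrite -addn1 PoszD [t%:Z + 1]addrC addrA.
Qed.

Lemma left_chain_boundaries t (j : int) (B : fgmod R)
    (inc : {linear B -> C (j + 1)}) :
  j <= -1 -> (forall i, i <= j - t%:Z -> is_zero (C i)) -> injective inc ->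
  (forall y, (exists z, inc z = y) <-> exists x, cdiff C j x = y) -> left_chain t B.
Proof.
elim: t j B inc => [|t IH] j.
  move=> B inc jle z0 ii iP x; apply: (inj_lin0 ii).
  have /iP[y <-] : exists z, inc z = inc x by exists x.
  by rewrite (_ : y = 0) ?linear0 //; apply: z0; rewrite subr0.
have [j' ->] : exists j', j = j' + 1 by exists (j - 1); rewrite subrK.
move=> B inc jle z0 ii iP /=.
have [B' [i' [ii' iP']]] := nR (im_submod (cdiff C j')).
have j1 : j' != -1 by rewrite lt_eqF // (lt_le_trans _ jle) // ltrDl.
have ex := exC j1.
have [x|g gE] := lin_lift (f := cdiff C (j' + 1)) ii.
  by apply/iP; exists x.
exists (C (j' + 1)), B', i', g; split=> //.
  split=> // [b|y].
    have /iP[x xE] : exists z, inc z = inc b by exists b.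
    by exists x; apply: ii; rewrite gE.
  split=> [gy|/iP' h]; first by apply/iP'/ex; rewrite -gE gy linear0.
  by apply: ii; rewrite gE linear0; apply/ex.
apply: (IH _ _ i') => //.
- by rewrite (le_trans _ jle) // lerDl.
- move=> i h; apply: z0; apply: le_trans h _.
  by rewrite -addn1 PoszD opprD addrACA subrr addr0.
by move=> y; split=> /iP'.
Qed.

(** The chains are those of the boundaries and the cycles in degree 0. When 0 is
    not between r and s, the cohomology vanishes. *)
Lemma cohomology_generated (d : nat) (H : fgmod R) (r s : int) :
  is_cohomology C (-1) H -> r <= s -> s - r <= d%:Z ->
  (forall j, (j < r) || (s < j) -> is_zero (C j)) ->
  generated_in (eq M) d.+1 H.
Proof.
move=> [K0 [inc0 [quo0 [ii0 iP0 qs0 qP0]]]] rs srd z0.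
have [K [inc [ii iP]]] := nR (ker_submod (cdiff C (-1 + 1))).
have [z|g gE] := lin_lift (f := inc) ii0.
  by apply/iP0/iP; exists z.
have gs : surj g.
  move=> x; have /iP0 /iP[z zE] : exists z, inc0 z = inc0 x by exists x.
  by exists z; apply: ii0; rewrite gE.
have [r0|r0] := ltP 0 r.
  apply: gen_is_zero => h; have [x <-] := qs0 h.
  rewrite (_ : x = 0) ?linear0 //; apply: (inj_lin0 ii0); apply: z0.
  by rewrite r0.
have [s0|s0] := ltP s 0.
  apply: gen_is_zero => h; have [x <-] := qs0 h.
  rewrite (_ : x = 0) ?linear0 //; apply: (inj_lin0 ii0); apply: z0.
  by rewrite s0 orbT.
have [B [iB [iBi iBP]]] := nR (im_submod (cdiff C (-1))).
have [p pE] : exists p : nat, r = - p%:Z.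
  by exists `|r|%N; rewrite lez0_abs ?opprK.
have pd : (p <= d)%N.
  by rewrite -lez_nat (le_trans _ srd) // pE opprK lerDr.
have sd : s <= (d - p)%N%:Z by rewrite -subzn // lerBrDr -[p%:Z]opprK -pE.
(* Zero terms above degree s make the total number of terms exactly d + 1. *)
have rK : right_chain (d - p).+1 K.
  apply: (right_chain_cycles (j := -1) (inc := inc)) => // i h.
  by apply: z0; rewrite (le_lt_trans sd) ?orbT.
have lB : left_chain p B.
  apply: (left_chain_boundaries (j := -1) (inc := iB)) => // [i h|y].
    by apply: z0; rewrite pE -[i < _]lezD1 addrC -lerBrDl addrC h.
  by split=> /iBP.
have [b|i iE] := lin_lift (f := iB) ii.
  have /iBP[x <-] : exists z, iB z = iB b by exists b.
  by apply/iP; exact: cdiffK.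
have sH : ses i (quo0 \o g).
  split.
  - by move=> x y /(congr1 inc); rewrite !iE => /iBi.
  - by move=> h; have [x <-] := qs0 h; have [z <-] := gs x; exists z.
  move=> z; split=> [/= /qP0 h|[b <-]] /=.
    have /iBP[b bE] : exists x, cdiff C (-1) x = inc z by rewrite -gE.
    by exists b; apply: ii; rewrite iE.
  by apply/qP0; rewrite gE iE; apply/iBP; exists b.
have := chain_generated sH lB rK.
by rewrite addnS subnKC.
Qed.
End Complex.
End Generation.

Lemma stable_dim_le_wrepdim (R : nzRingType) : noetherian R ->
  (2%:E + stable_dim R <= wrepdim R)%E.
Proof.
move=> nR; rewrite /wrepdim; set Q := (X in (_ <= least X)%E).
have [[i [[i2 [M MP]] ->]]|->] := leastP Q; last exact: leey.
have le : (stable_dim R <= ((i - 2)%N%:Z)%:E)%E.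
  apply: least_le; exists M => L.
  have [C [aC [H cH sH] exC [r [s [rs srd z0]]]]] := MP L.
  have gC j : generated (eq M) (C j) by apply: (gen_add nR) (aC j); exact: gen_in.
  have gH : generated_in (eq M) (i - 2).+1 H.
    by apply: (cohomology_generated nR gC exC cH rs) => //; rewrite -subzn.
  by apply: (gen_retract nR) gH; apply/(direct_summandP nR).
have -> : ((i%:Z)%:E = 2%:E + ((i - 2)%N%:Z)%:E)%E.
  by rewrite -EFinD -subzn // addrC subrK.
exact: leeD2l.
Qed.

Unset Implicit Arguments.

Theorem proposition8p6 (k : fieldType) (A : falgType k)
    (nss : ~ semisimple A) (inj : self_injective A) :
  [/\ (repdim A <= loewy_length A)%E,
      (wrepdim A <= repdim A)%E &
      (2%:E + stable_dim A <= wrepdim A)%E].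
Proof.
split; first exact: repdim_le_loewy.
  exact: wrepdim_le_repdim.
exact/stable_dim_le_wrepdim/noetherian_falg.
Qed.
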